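(* Let $A$ be a finite dimensional algebra over a field $k$. Then $A$ is quasi-hereditary if and only if $A$ has a divisible cellular system $\mathfrak{c}(\Lambda;I,J,D)$ with $\Lambda=\Lambda_{\mathrm{irr}}$. The latter condition is equivalent to the condition that $A$ has a full divisible cellular system.
   Context: $k$ is a field; $k$-algebras are associative with identity; modules are left modules unless called right modules. A finite dimensional $k$-algebra $A$ is quasi-hereditary if it has a chain of two-sided ideals $0=J_0\subset J_1\subset\cdots\subset J_n=A$ (a heredity chain) such that each $J_i/J_{i-1}$ is a heredity ideal of $A/J_{i-1}$; an ideal $H$ of a finite dimensional algebra $B$ is a heredity ideal if $H^2=H$, $H$ is projective as a left $B$-module, and $H\,\mathrm{rad}(B)\,H=0$. (Equivalently, the category of finite dimensional $A$-modules is a highest weight category.) Cellular system. Let $A$ be a $k$-algebra and $\Lambda$ a poset. A cellular system $\mathfrak{c}=\mathfrak{c}(\Lambda;I,J,D)$ of $A$ consists of, for each $\lambda\in\Lambda$, nonempty index sets $I(\lambda),J(\lambda)$ and a $k$-algebra $D(\lambda)$ with 1, and for each $(i,j)\in I(\lambda)\times J(\lambda)$ an injective $k$-linear map (not necessarily an algebra homomorphism) $c^\lambda_{i,j}:D(\lambda)\to A$, such that: (a) $A=\bigoplus_{\lambda\in\Lambda}\bigoplus_{i\in I(\lambda),j\in J(\lambda)}c^\lambda_{i,j}(D(\lambda))$; (b) for all $a\in A$, $\lambda\in\Lambda$, $i\in I(\lambda)$, $j\in J(\lambda)$ and $x\in D(\lambda)$, $$a\,c^\lambda_{i,j}(x)\equiv\sum_{i'\in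 I(\lambda)}c^\lambda_{i',j}(f^\lambda_{i'}(a,i)x)\pmod{A^{>\lambda}},\qquad c^\lambda_{i,j}(x)\,a\equiv\sum_{j'\in J(\lambda)}c^\lambda_{i,j'}(x\,g^\lambda_{j'}(j,a))\pmod{A^{>\lambda}},$$ where $f^\lambda_{i'}(a,i)\in D(\lambda)$ is independent of $j$ and $x$, $g^\lambda_{j'}(j,a)\in D(\lambda)$ is independent of $i$ and $x$ (all but finitely many terms being zero), and $A^{>\lambda}=\bigoplus_{\mu>\lambda}\bigoplus_{i\in I(\mu),j\in J(\mu)}c^\mu_{i,j}(D(\mu))$. Standard modules. $\Delta(\lambda)=\bigoplus_{i\in I(\lambda)}a^\lambda_i(D(\lambda))$, with $a_i^\lambda:D(\lambda)\to\Delta(\lambda)$ injective $k$-linear maps, is the $A$-$D(\lambda)$-bimodule with $a\cdot a^\lambda_i(x)=\sum_{i'}a^\lambda_{i'}(f^\lambda_{i'}(a,i)x)$ and $a^\lambda_i(x)\cdot y=a^\lambda_i(xy)$. $\Delta^{\mathrm{op}}(\lambda)=\bigoplus_{j\in J(\lambda)}b^\lambda_j(D(\lambda))$, with $b_j^\lambda:D(\lambda)\to\Delta^{\mathrm{op}}(\lambda)$ injective $k$-linear maps, is the $D(\lambda)$-$A$-bimodule with $b^\lambda_j(x)\cdot a=\sum_{j'}b^\lambda_{j'}(x\,g^\lambda_{j'}(j,a))$ and $y\cdot b^\lambda_j(x)=b^\lambda_j(yx)$. The map $\varphi_\lambda$. For $j\in J(\lambda)$, $i'\in I(\lambda)$ there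 is a unique $f^\lambda(j,i')\in D(\lambda)$ (independent of $i,j'$) with $c^\lambda_{i,j}(1)c^\lambda_{i',j'}(1)\equiv c^\lambda_{i,j'}(f^\lambda(j,i'))\pmod{A^{>\lambda}}$ for all $i\in I(\lambda)$, $j'\in J(\lambda)$. The map $\varphi_\lambda:\Delta^{\mathrm{op}}(\lambda)\otimes_A\Delta(\lambda)\to D(\lambda)$ is the $D(\lambda)$-$D(\lambda)$-bimodule homomorphism with $\varphi_\lambda(b^\lambda_j(x)\otimes a^\lambda_i(y))=x f^\lambda(j,i)y$. $\Lambda_{\mathrm{irr}}=\{\lambda\in\Lambda\mid\varphi_\lambda\neq0\}$. The system is divisible if every $D(\lambda)$ is a division ring, and full if $\mathrm{im}(\varphi_\lambda)=D(\lambda)$ for every $\lambda\in\Lambda$. *)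

(* Defs.v *)
From HB Require Import structures.
From mathcomp Require Import all_boot all_order all_algebra all_field.
From mathcomp Require Import boolp classical_sets.
From mathcomp Require Import finmap monalg.

Set Implicit Arguments.
Unset Strict Implicit.
Unset Printing Implicit Defensive.

Import Order.TTheory GRing.Theory.

Local Open Scope ring_scope.
Local Open Scope quotient_scope.

(* Rings are allowed to be trivial (pzRingType), since A / J is when J = A.
   The structures of ring_quotient only cover proper ideals of commutative
   rings. *)

Record left_ideal (R : pzRingType) := LeftIdeal {
  left_ideal_pred :> {pred R};
  left_ideal_zmod : zmod_closed left_ideal_pred;
  left_idealM : forall a x, x \in left_ideal_pred -> a * x \in left_ideal_pred
}.

Record ideal (R : pzRingType) := Ideal {
  ideal_left :> left_ideal R;
  idealMr : forall a x, x \in ideal_left -> x * a \in ideal_left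
}.

HB.instance Definition _ (R : pzRingType) (I : left_ideal R) :=
  GRing.isZmodClosed.Build R (left_ideal_pred I) (left_ideal_zmod I).

Section LeftIdealModule.
Variables (R : pzRingType) (I : left_ideal R).

Record left_ideal_mod := LeftIdealMod {
  left_ideal_val :> R; _ : left_ideal_val \in left_ideal_pred I }.

HB.instance Definition _ := [isSub for left_ideal_val].
HB.instance Definition _ := [Choice of left_ideal_mod by <:].
HB.instance Definition _ := [SubChoice_isSubZmodule of left_ideal_mod by <:].

Definition left_ideal_scale (a : R) (x : left_ideal_mod) : left_ideal_mod :=
  LeftIdealMod (left_idealM a (valP x)).

Fact left_ideal_scaleA a b x :
  left_ideal_scale a (left_ideal_scale b x) = left_ideal_scale (a * b) x.
Proof. by apply: val_inj; rewrite /= mulrA. Qed.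
Fact left_ideal_scale1 : left_id 1 left_ideal_scale.
Proof. by move=> x; apply: val_inj; rewrite /= mul1r. Qed.
Fact left_ideal_scaleDr : right_distributive left_ideal_scale +%R.
Proof. by move=> a x y; apply: val_inj; rewrite /= mulrDr. Qed.
Fact left_ideal_scaleDl x : {morph left_ideal_scale^~ x : a b / a + b}.
Proof. by move=> a b; apply: val_inj; rewrite /= mulrDl. Qed.

HB.instance Definition _ := GRing.Zmodule_isLmodule.Build R left_ideal_mod
  left_ideal_scaleA left_ideal_scale1 left_ideal_scaleDr left_ideal_scaleDl.

End LeftIdealModule.

Section IdealQuotient.
Variables (R : pzRingType) (I : ideal R).

Definition ring_quot : Type := Quotient.quot (left_ideal_pred I).

HB.instance Definition _ := GRing.Zmodule.on ring_quot.

Definition quot_pi (x : R) : ring_quot := \pi_(Quotient.quot (left_ideal_pred I)) x.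
Definition quot_repr (x : ring_quot) : R :=
  repr (x : Quotient.quot (left_ideal_pred I)).

Lemma quot_reprK : cancel quot_repr quot_pi.
Proof. by move=> x; rewrite /quot_pi /quot_repr reprK. Qed.

Lemma quot_pi_eq x y : (quot_pi x == quot_pi y) = (x - y \in left_ideal_pred I).
Proof. by rewrite Quotient.idealrBE. Qed.

Lemma quot_piD x y : quot_pi (x + y) = quot_pi x + quot_pi y.
Proof. by rewrite /quot_pi [LHS]pi_addr. Qed.

Lemma quot_piB x y : quot_pi (x - y) = quot_pi x - quot_pi y.
Proof. by apply/eqP; rewrite eq_sym subr_eq -quot_piD subrK. Qed.

Lemma quot_pi0 : quot_pi 0 = 0.
Proof. by rewrite -(subrr 0) quot_piB subrr. Qed.

Definition quot_one : ring_quot := quot_pi 1.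
Definition quot_mul (x y : ring_quot) : ring_quot :=
  quot_pi (quot_repr x * quot_repr y).

Lemma quot_piM x y : quot_pi (x * y) = quot_mul (quot_pi x) (quot_pi y).
Proof.
have Hx : x - quot_repr (quot_pi x) \in left_ideal_pred I.
  by rewrite -quot_pi_eq quot_reprK.
have Hy : y - quot_repr (quot_pi y) \in left_ideal_pred I.
  by rewrite -quot_pi_eq quot_reprK.
apply/eqP; rewrite quot_pi_eq -(subrK (quot_repr (quot_pi x) * y) (x * y)).
by rewrite -addrA -mulrBl -mulrBr rpredD // ?(left_idealM _ Hy) ?(idealMr _ Hx).
Qed.

Fact quot_mulA : associative quot_mul.
Proof.
move=> x y z; rewrite -[x]quot_reprK -[y]quot_reprK -[z]quot_reprK.
by rewrite -!quot_piM mulrA.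
Qed.
Fact quot_mul1l : left_id quot_one quot_mul.
Proof. by move=> x; rewrite -[x]quot_reprK -quot_piM mul1r. Qed.
Fact quot_mul1r : right_id quot_one quot_mul.
Proof. by move=> x; rewrite -[x]quot_reprK -quot_piM mulr1. Qed.
Fact quot_mulDl : left_distributive quot_mul +%R.
Proof.
move=> x y z; rewrite -[x]quot_reprK -[y]quot_reprK -[z]quot_reprK.
by rewrite -quot_piD -!quot_piM -quot_piD mulrDl.
Qed.
Fact quot_mulDr : right_distributive quot_mul +%R.
Proof.
move=> x y z; rewrite -[x]quot_reprK -[y]quot_reprK -[z]quot_reprK.
by rewrite -quot_piD -!quot_piM -quot_piD mulrDr.
Qed.

HB.instance Definition _ := GRing.Zmodule_isPzRing.Build ring_quot
  quot_mulA quot_mul1l quot_mul1r quot_mulDl quot_mulDr.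

(* The ideal I' / I of R / I, for I included in I'. *)
Section QuotientIdeal.
Variables (I' : ideal R) (sII' : {subset I <= I'}).

Definition quot_ideal_pred : {pred ring_quot} := [pred x | quot_repr x \in I'].

Lemma quot_ideal_pi x : (quot_pi x \in quot_ideal_pred) = (x \in I').
Proof.
have Hx : quot_repr (quot_pi x) - x \in left_ideal_pred I'.
  by apply: sII'; rewrite -[_ \in _]quot_pi_eq quot_reprK.
by rewrite inE /= -[in LHS](subrK x (quot_repr _)) rpredDl.
Qed.

Fact quot_ideal_zmod : zmod_closed quot_ideal_pred.
Proof.
split=> [|x y]; first by rewrite -quot_pi0 quot_ideal_pi [_ \in _]rpred0.
rewrite -[x]quot_reprK -[y]quot_reprK -quot_piB !quot_ideal_pi.
exact: rpredB.
Qed.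

Fact quot_idealMl a x : x \in quot_ideal_pred -> a * x \in quot_ideal_pred.
Proof.
rewrite -[x]quot_reprK -[a]quot_reprK -[_ * _]quot_piM !quot_ideal_pi.
exact: left_idealM.
Qed.

Fact quot_idealMr a x : x \in quot_ideal_pred -> x * a \in quot_ideal_pred.
Proof.
rewrite -[x]quot_reprK -[a]quot_reprK -[_ * _]quot_piM !quot_ideal_pi.
exact: idealMr.
Qed.

Definition quot_ideal : ideal ring_quot :=
  @Ideal _ (LeftIdeal quot_ideal_zmod quot_idealMl) quot_idealMr.

End QuotientIdeal.
End IdealQuotient.

Definition projective (R : pzRingType) (P : lmodType R) : Prop :=
  forall (M N : lmodType R) (g : {linear M -> N}) (f : {linear P -> N}),
    (forall y, exists x, g x = y) ->
  exists h : {linear P -> M}, forall x, g (h x) = f x.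

Definition maximal_left_ideal (R : pzRingType) (M : left_ideal R) : Prop :=
  1 \notin M /\
  forall M' : left_ideal R,
    {subset M <= M'} -> 1 \notin M' -> {subset M' <= M}.

Definition jacobson_radical (R : pzRingType) (x : R) : Prop :=
  forall M : left_ideal R, maximal_left_ideal M -> x \in M.

Record heredity_ideal (R : pzRingType) (H : ideal R) : Prop := HeredityIdeal {
  heredity_idempotent : forall x, x \in H <->
    exists (n : nat) (u v : 'I_n -> R),
      (forall t, u t \in H /\ v t \in H) /\ x = \sum_t u t * v t;
  heredity_projective : projective (left_ideal_mod H);
  heredity_radical : forall x r y,
    x \in H -> jacobson_radical r -> y \in H -> x * r * y = 0
}.

(* The chain J_0 <= ... <= J_n is indexed by nat; as J_n = A, all the later
   terms equal A. Inclusions need not be strict: 0 is a heredity ideal. *)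
Definition quasi_hereditary (A : pzRingType) : Prop :=
  exists (n : nat) (J : nat -> ideal A)
         (sJ : forall i, {subset J i <= J i.+1}),
  [/\ forall x, x \in J 0 <-> x = 0,
      forall x, x \in J n
    & forall i, (i < n)%N -> heredity_ideal (quot_ideal (sJ i))].

Section FreeSum.
Variables (K : choiceType) (G V : zmodType) (h : K -> {additive G -> V}).

Definition msum (g : {malg G[K]}) : V := \sum_(k <- msupp g) h k g@_k.

Lemma msumEw (d : {fset K}) g :
  (msupp g `<=` d)%fset -> msum g = \sum_(k <- d) h k g@_k.
Proof.
move=> le; rewrite /msum (big_fset_incl _ le) //= => x xd /mcoeff_outdom ->.
by rewrite raddf0.
Qed.

Lemma msumU x k : msum << x *g k >> = h k x.
Proof. by rewrite (msumEw msuppU_le) big_seq_fset1 mcoeffUU. Qed.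

Lemma msumB : zmod_morphism msum.
Proof.
move=> g1 g2; pose d := (msupp g1 `|` msupp g2)%fset.
rewrite (@msumEw d (g1 - g2)) ?(@msumEw d g1) ?(@msumEw d g2);
  rewrite ?fsubsetUl ?fsubsetUr ?msuppB_le //.
by rewrite -sumrB; apply: eq_bigr => k _; rewrite mcoeffB raddfB.
Qed.

HB.instance Definition _ := GRing.isZmodMorphism.Build {malg G[K]} V msum msumB.

End FreeSum.

Lemma malg_eq_additive (K : choiceType) (G V : zmodType)
    (f g : {additive {malg G[K]} -> V}) :
  (forall x k, f << x *g k >> = g << x *g k >>) -> f =1 g.
Proof.
move=> fg u; rewrite [u]monalgE !raddf_sum.
by apply: eq_bigr => k _; apply: fg.
Qed.

(* Tensor product of a right module M, seen as a left module over the opposite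
   ring A^c, and a left module N. *)
Section Tensor.
Variables (A : pzRingType) (M : lmodType A^c) (N : lmodType A).

(* The subgroup of the free abelian group on M * N spanned by the relations. *)
Inductive tensor_rel : {malg int[(M * N)%type]} -> Prop :=
| tensor_rel0 : tensor_rel 0
| tensor_relB z z' of tensor_rel z & tensor_rel z' : tensor_rel (z - z')
| tensor_relDl u u' v : tensor_rel
    (<< (u + u', v) >> - << (u, v) >> - << (u', v) >>)
| tensor_relDr u v v' : tensor_rel
    (<< (u, v + v') >> - << (u, v) >> - << (u, v') >>)
| tensor_relM u (a : A) v : tensor_rel
    (<< ((a : A^c) *: u, v) >> - << (u, a *: v) >>).

Definition tensor_rel_pred : {pred {malg int[(M * N)%type]}} := fun z => `[< tensor_rel z >].

Fact tensor_rel_zmod : zmod_closed tensor_rel_pred.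
Proof.
split=> [|x y /asboolP Hx /asboolP Hy]; apply/asboolP; first exact: tensor_rel0.
exact: tensor_relB.
Qed.

HB.instance Definition _ := GRing.isZmodClosed.Build _ tensor_rel_pred
  tensor_rel_zmod.

Definition tensor : Type := Quotient.quot tensor_rel_pred.

HB.instance Definition _ := GRing.Zmodule.on tensor.

Definition tensor_pi (z : {malg int[(M * N)%type]}) : tensor :=
  \pi_(Quotient.quot tensor_rel_pred) z.

Definition tens (u : M) (v : N) : tensor := tensor_pi << (u, v) >>.

Lemma tensor_piB : zmod_morphism tensor_pi.
Proof. by move=> x y; rewrite /tensor_pi [LHS]raddfB. Qed.

HB.instance Definition _ := GRing.isZmodMorphism.Build _ _ tensor_pi tensor_piB.

Lemma tensor_pi_eq x y : tensor_pi x = tensor_pi y <-> tensor_rel (x - y).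
Proof.
have E : (x - y \in tensor_rel_pred) = (tensor_pi x == tensor_pi y).
  by rewrite Quotient.idealrBE.
split=> [/eqP|H]; first by rewrite -E => /asboolP.
by apply/eqP; rewrite -E; apply/asboolP.
Qed.

(* The additive map on the tensor product induced by a balanced map. *)
Section Lift.
Variables (G : zmodType) (h : M -> N -> G).
Hypothesis hDl : forall u u' v, h (u + u') v = h u v + h u' v.
Hypothesis hDr : forall u v v', h u (v + v') = h u v + h u v'.
Hypothesis hM : forall u (a : A) v, h ((a : A^c) *: u) v = h u (a *: v).

Local Notation hmsum := (msum (fun p : M * N => intmul (h p.1 p.2))).

Definition tensor_lift (t : tensor) : G :=
  hmsum (repr (t : Quotient.quot tensor_rel_pred)).

Let msum_rel z : tensor_rel z -> hmsum z = 0.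
Proof.
elim=> [|? ? _ H1 _ H2|u u' v|u v v'|u a v];
  rewrite ?raddf0 ?raddfB /= ?msumU /= ?mulr1z //.
- by rewrite H1 H2 subrr.
- by rewrite hDl addrAC addrK subrr.
- by rewrite hDr addrAC addrK subrr.
- by rewrite hM subrr.
Qed.

Lemma tensor_lift_pi z : tensor_lift (tensor_pi z) = hmsum z.
Proof.
apply/eqP; rewrite -subr_eq0 /tensor_lift -raddfB; apply/eqP/msum_rel.
by apply/tensor_pi_eq; rewrite /tensor_pi reprK.
Qed.

Lemma tensor_lift_tens u v : tensor_lift (tens u v) = h u v.
Proof. by rewrite /tens tensor_lift_pi msumU. Qed.

Lemma tensor_liftB : zmod_morphism tensor_lift.
Proof.
move=> x y; rewrite -[x]reprK -[y]reprK -!/(tensor_pi _).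
by rewrite -raddfB !tensor_lift_pi raddfB.
Qed.

End Lift.
End Tensor.

(* The sum of the additive subgroups W t with P t, and the assertion that V is
   the internal direct sum of all the W t. *)
Definition family_sum (V : zmodType) (T : Type) (W : T -> V -> Prop)
    (P : T -> Prop) (x : V) : Prop :=
  exists s : seq V,
    (forall v, v \in s -> exists t, P t /\ W t v) /\ x = \sum_(v <- s) v.

Definition internal_direct_sum (V : zmodType) (T : eqType)
    (W : T -> V -> Prop) : Prop :=
  (forall x, family_sum W (fun=> True) x) /\
  (forall (s : seq T) (v : T -> V),
     uniq s -> (forall t, t \in s -> W t (v t)) -> \sum_(t <- s) v t = 0 ->
   forall t, t \in s -> v t = 0).

Section CellularSystem.
Variables (k : fieldType) (A : algType k).
Variables (d : Order.disp_t) (L : porderType d).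
Variables (I J : L -> choiceType) (D : L -> algType k).

Definition cell_index := {l : L & (I l * J l)%type}.

Definition cell_image (c : forall l, I l -> J l -> {linear D l -> A})
    (t : cell_index) (a : A) : Prop :=
  exists x, a = c (tag t) (tagged t).1 (tagged t).2 x.

(* membership in A^{> l} *)
Definition cell_gt (c : forall l, I l -> J l -> {linear D l -> A})
    (l : L) (a : A) : Prop :=
  family_sum (cell_image c) (fun t => (l < tag t)%O) a.

(* {malg G[K]} is the type of finitely supported functions from K to G; only
   its additive structure is used. Thus (cell_f c a i)@_i' stands for
   f^l_{i'}(a, i). *)
Record cellular_system := CellularSystem {
  cell_I0 : forall l, inhabited (I l);
  cell_J0 : forall l, inhabited (J l);
  cell : forall l, I l -> J l -> {linear D l -> A};
  cell_inj : forall l i j, injective (@cell l i j);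
  cell_direct : internal_direct_sum (cell_image cell);
  cell_f : forall l, A -> I l -> {malg D l[I l]};
  cell_g : forall l, J l -> A -> {malg D l[J l]};
  cell_mull : forall a l i j (x : D l),
    cell_gt cell l
      (a * cell i j x
       - \sum_(i' <- msupp (cell_f a i)) cell i' j ((cell_f a i)@_i' * x));
  cell_mulr : forall a l i j (x : D l),
    cell_gt cell l
      (cell i j x * a
       - \sum_(j' <- msupp (cell_g j a)) cell i j' (x * (cell_g j a)@_j'))
}.

End CellularSystem.

Arguments cellular_system {k} A {d L} I J D.
Arguments cell_gt {k A d L I J D} c l a.

Lemma big_uniq_sub (T : eqType) (V : zmodType) (s s' : seq T) (F : T -> V) :
  uniq s -> uniq s' -> {subset s <= s'} -> (forall t, t \notin s -> F t = 0) ->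
  \sum_(t <- s') F t = \sum_(t <- s) F t.
Proof.
move=> us us' ss' F0; rewrite (bigID (mem s)) /= [X in _ + X]big1 // addr0.
rewrite -big_filter; apply/perm_big/uniq_perm; rewrite ?filter_uniq // => t.
by rewrite mem_filter andb_idr //; apply: ss'.
Qed.

Section Coordinates.
Variables (k : fieldType) (A : algType k).
Variables (d : Order.disp_t) (L : porderType d).
Variables (I J : L -> choiceType) (D : L -> algType k).
Variable c : cellular_system A I J D.

Local Notation T := (cell_index I J).
Let cc (t : T) : {linear D (tag t) -> A} := cell c (tagged t).1 (tagged t).2.
Let idx l (i : I l) (j : J l) : T := Tagged (fun l => (I l * J l)%type) (i, j).

Definition is_coord (a : A) (x : forall t : T, D (tag t)) : Prop :=
  exists s : seq T, [/\ uniq s, forall t, t \notin s -> x t = 0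
                     & a = \sum_(t <- s) cc t (x t)].

Lemma is_coord_uniq a x y : is_coord a x -> is_coord a y -> forall t, x t = y t.
Proof.
move=> [s [us xs ->]] [s' [us' ys e]] t.
pose s2 := undup (s ++ s').
have us2 : uniq s2 by rewrite undup_uniq.
have ss2 : {subset s <= s2} by move=> u; rewrite mem_undup mem_cat => ->.
have ss2' : {subset s' <= s2} by move=> u; rewrite mem_undup mem_cat orbC => ->.
move: e; rewrite -(big_uniq_sub us us2 ss2) => [|u /xs->]; last exact: raddf0.
rewrite -(big_uniq_sub us' us2 ss2') => [|u /ys->]; last exact: raddf0.
move/eqP; rewrite -subr_eq0 -sumrB => /eqP e.
have [ts2|] := boolP (t \in s2); last first.
  by rewrite mem_undup mem_cat negb_or => /andP[/xs-> /ys->].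
have := (cell_direct c).2 s2 (fun t => cc t (x t) - cc t (y t)) us2 _ e t ts2.
move=> /(_ _)/eqP; rewrite subr_eq0 => H; apply/(@cell_inj _ _ _ _ _ _ _ c)/eqP/H.
by move=> u _; exists (x u - y u); rewrite raddfB.
Qed.

Lemma is_coordD a b x y :
  is_coord a x -> is_coord b y -> is_coord (a + b) (fun t => x t + y t).
Proof.
move=> [s [us xs ->]] [s' [us' ys ->]].
pose s2 := undup (s ++ s').
have us2 : uniq s2 by rewrite undup_uniq.
have ss2 : {subset s <= s2} by move=> u; rewrite mem_undup mem_cat => ->.
have ss2' : {subset s' <= s2} by move=> u; rewrite mem_undup mem_cat orbC => ->.
exists s2; split=> // [t|].
  by rewrite mem_undup mem_cat negb_or => /andP[/xs-> /ys->]; rewrite addr0.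
rewrite -(big_uniq_sub us us2 ss2) => [|u /xs->]; last exact: raddf0.
rewrite -(big_uniq_sub us' us2 ss2') => [|u /ys->]; last exact: raddf0.
by rewrite -big_split; apply: eq_bigr => t _; rewrite raddfD.
Qed.

Lemma is_coordN a x : is_coord a x -> is_coord (- a) (fun t => - x t).
Proof.
move=> [s [us xs ->]]; exists s; split=> // [t /xs->|]; first exact: oppr0.
by rewrite -sumrN; apply: eq_bigr => t _; rewrite raddfN.
Qed.

Lemma is_coord_cell (t : T) (x : D (tag t)) :
  is_coord (cc t x) (@dfwith T (fun t => D (tag t)) (fun=> 0) t x).
Proof.
exists [:: t]; split=> // [u|]; last by rewrite big_seq1 dfwith_in.
by rewrite inE eq_sym => tu; rewrite dfwith_out.
Qed.

Lemma is_coord_ex a : exists x, is_coord a x.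
Proof.
have [s [cs ->]] := (cell_direct c).1 a.
elim: s cs => [|v s IH] cs; rewrite ?big_nil ?big_cons.
  by exists (fun=> 0), [::]; rewrite big_nil.
have [|x sx] := IH; first by move=> u us; apply: cs; rewrite inE us orbT.
have [|t [_ [y ->]]] := cs v; first by rewrite mem_head.
by eexists; apply: is_coordD sx; apply: is_coord_cell.
Qed.

Definition cell_coord l (i : I l) (j : J l) (a : A) : D l :=
  projT1 (cid (is_coord_ex a)) (idx i j).

Lemma cell_coordE l (i : I l) (j : J l) a x :
  is_coord a x -> cell_coord i j a = x (idx i j).
Proof.
by move=> ax; exact: (is_coord_uniq (projT2 (cid (is_coord_ex a))) ax (idx i j)).
Qed.

Lemma cell_coordB l (i : I l) (j : J l) : zmod_morphism (cell_coord i j).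
Proof.
move=> a b; have [[x ax] [y bY]] := (is_coord_ex a, is_coord_ex b).
rewrite (cell_coordE _ _ ax) (cell_coordE _ _ bY).
by rewrite (cell_coordE _ _ (is_coordD ax (is_coordN bY))).
Qed.

HB.instance Definition _ l i j :=
  GRing.isZmodMorphism.Build A (D l) (cell_coord i j) (cell_coordB i j).

Lemma cell_coord_id l (i : I l) (j : J l) x : cell_coord i j (cell c i j x) = x.
Proof. by rewrite (cell_coordE _ _ (@is_coord_cell (idx i j) x)) dfwith_in. Qed.

Lemma cell_coord_neq (t : T) l (i : I l) (j : J l) x :
  t != idx i j -> cell_coord i j (cell c (tagged t).1 (tagged t).2 x) = 0.
Proof.
by move=> ne; rewrite (cell_coordE _ _ (@is_coord_cell t x)) dfwith_out.
Qed.

Lemma idx_eq l (i i' : I l) (j j' : J l) :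
  (idx i j == idx i' j') = (i == i') && (j == j').
Proof. by rewrite eq_Tagged. Qed.

Lemma cell_coord_cell l (i i' : I l) (j j' : J l) x :
  cell_coord i' j' (cell c i j x) = x *+ ((i == i') && (j == j')).
Proof.
case: andP => [[/eqP<- /eqP<-]|ne]; first by rewrite cell_coord_id mulr1n.
by rewrite (@cell_coord_neq (idx i j)) // idx_eq; apply/negP => /andP.
Qed.

Lemma cell_coord_gt l (i : I l) (j : J l) a :
  cell_gt (cell c) l a -> cell_coord i j a = 0.
Proof.
case=> s [cs ->]; rewrite raddf_sum big_seq big1 // => v /cs [t [lt [x ->]]].
apply: cell_coord_neq; apply: contraTneq lt => ->.
by rewrite ltxx.
Qed.

Lemma cell_gt0 l : cell_gt (cell c) l 0.
Proof. by exists [::]; rewrite big_nil. Qed.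

Lemma cell_gtD l a b :
  cell_gt (cell c) l a -> cell_gt (cell c) l b -> cell_gt (cell c) l (a + b).
Proof.
move=> [s [cs ->]] [s' [cs' ->]]; exists (s ++ s'); rewrite big_cat; split=> // v.
by rewrite mem_cat => /orP[/cs|/cs'].
Qed.

Lemma cell_gt_cell l m (i : I m) (j : J m) x :
  (l < m)%O -> cell_gt (cell c) l (cell c i j x).
Proof.
move=> lm; exists [:: cell c i j x]; rewrite big_seq1; split=> // v.
by rewrite inE => /eqP->; exists (idx i j); split=> //; exists x.
Qed.

Lemma cell_gtN l a : cell_gt (cell c) l a -> cell_gt (cell c) l (- a).
Proof.
case=> s [cs ->]; exists (map -%R s); split; last by rewrite big_map sumrN.
move=> v /mapP[u /cs[t [lt [x ->]]] ->]; exists t; split=> //.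
by exists (- x); rewrite raddfN.
Qed.

Lemma cell_gtB l a b :
  cell_gt (cell c) l a -> cell_gt (cell c) l b -> cell_gt (cell c) l (a - b).
Proof. by move=> Ha Hb; apply: cell_gtD => //; apply: cell_gtN. Qed.

Lemma cell_gt_sum (S : eqType) (s : seq S) l (F : S -> A) :
  (forall t, t \in s -> cell_gt (cell c) l (F t)) ->
  cell_gt (cell c) l (\sum_(t <- s) F t).
Proof.
move=> H; rewrite big_seq; elim/big_ind: _ => //; first exact: cell_gt0.
by move=> a b; apply: cell_gtD.
Qed.

Lemma cell_gt_malg (K : choiceType) (G : zmodType) l
    (f g : {additive {malg G[K]} -> A}) :
  (forall x i, cell_gt (cell c) l (f << x *g i >> - g << x *g i >>)) ->
  forall u, cell_gt (cell c) l (f u - g u).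
Proof.
move=> H u; rewrite [u]monalgE (raddf_sum f) (raddf_sum g) -sumrB.
by apply: cell_gt_sum => i _; apply: H.
Qed.

Lemma cell_gt_trans l m a : (l < m)%O -> cell_gt (cell c) m a -> cell_gt (cell c) l a.
Proof.
move=> lm [s [cs ->]]; exists s; split=> // v /cs[t [mt vt]].
by exists t; split=> //; apply: lt_trans mt.
Qed.

Lemma cell_gtMl l a b : cell_gt (cell c) l b -> cell_gt (cell c) l (a * b).
Proof.
case=> s [cs ->]; rewrite mulr_sumr; apply: cell_gt_sum => v /cs[[m [i j]] [lm [x ->]]].
rewrite -(subrK (\sum_(i' <- msupp (cell_f c a i)) cell c i' j ((cell_f c a i)@_i' * x)) (a * _)).
apply: cell_gtD; first exact: cell_gt_trans lm (cell_mull c a i j x).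
by apply: cell_gt_sum => i' _; apply: cell_gt_cell.
Qed.

Lemma cell_gtMr l a b : cell_gt (cell c) l b -> cell_gt (cell c) l (b * a).
Proof.
case=> s [cs ->]; rewrite mulr_suml; apply: cell_gt_sum => v /cs[[m [i j]] [lm [x ->]]].
rewrite -(subrK (\sum_(j' <- msupp (cell_g c j a)) cell c i j' (x * (cell_g c j a)@_j')) (_ * a)).
apply: cell_gtD; first exact: cell_gt_trans lm (cell_mulr c a i j x).
by apply: cell_gt_sum => j' _; apply: cell_gt_cell.
Qed.

End Coordinates.

Section CoefficientAction.
Variables (K : choiceType) (D : nzRingType) (g : {malg D[K]}).

Definition malg_mulr (x : D) : {malg D[K]} := \sum_(k <- msupp g) << g@_k * x *g k >>.
Definition malg_mull (x : D) : {malg D[K]} := \sum_(k <- msupp g) << x * g@_k *g k >>.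

Fact malg_mulrB : zmod_morphism malg_mulr.
Proof.
move=> x y; rewrite /malg_mulr -sumrB; apply: eq_bigr => k _.
by rewrite mulrBr raddfB.
Qed.
Fact malg_mullB : zmod_morphism malg_mull.
Proof.
move=> x y; rewrite /malg_mull -sumrB; apply: eq_bigr => k _.
by rewrite mulrBl raddfB.
Qed.

HB.instance Definition _ := GRing.isZmodMorphism.Build D {malg D[K]} malg_mulr malg_mulrB.
HB.instance Definition _ := GRing.isZmodMorphism.Build D {malg D[K]} malg_mull malg_mullB.

Lemma msum_malg_mulr (V : zmodType) (h : K -> {additive D -> V}) x :
  msum h (malg_mulr x) = \sum_(k <- msupp g) h k (g@_k * x).
Proof. by rewrite [LHS](raddf_sum (msum h)); apply: eq_bigr => k _; rewrite /= msumU. Qed.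

Lemma msum_malg_mull (V : zmodType) (h : K -> {additive D -> V}) x :
  msum h (malg_mull x) = \sum_(k <- msupp g) h k (x * g@_k).
Proof. by rewrite [LHS](raddf_sum (msum h)); apply: eq_bigr => k _; rewrite /= msumU. Qed.

Lemma mcoeff_malg_mulr x k : mcoeff k (malg_mulr x) = mcoeff k g * x.
Proof.
rewrite /malg_mulr (raddf_sum (mcoeff k)) /=; have [ks|ks] := boolP (k \in msupp g).
  rewrite (big_fsetD1 k) //= mcoeffU eqxx big_seq big1 ?addr0 // => k1.
  by rewrite !inE => /andP[/negPf ne _]; rewrite mcoeffU ne.
rewrite mcoeff_outdom // mul0r big_seq big1 // => k1 k1s.
by rewrite mcoeffU; case: eqP => // e; move: ks; rewrite -e k1s.
Qed.

Lemma mcoeff_malg_mull x k : mcoeff k (malg_mull x) = x * mcoeff k g.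
Proof.
rewrite /malg_mull (raddf_sum (mcoeff k)) /=; have [ks|ks] := boolP (k \in msupp g).
  rewrite (big_fsetD1 k) //= mcoeffU eqxx big_seq big1 ?addr0 // => k1.
  by rewrite !inE => /andP[/negPf ne _]; rewrite mcoeffU ne.
rewrite mcoeff_outdom // mulr0 big_seq big1 // => k1 k1s.
by rewrite mcoeffU; case: eqP => // e; move: ks; rewrite -e k1s.
Qed.

End CoefficientAction.

Section StandardModuleTypes.
Variables (k : fieldType) (A : algType k).
Variables (d : Order.disp_t) (L : porderType d).
Variables (I J : L -> choiceType) (D : L -> algType k).

(* The system c, which these types do not depend on, determines the action of A. *)
Definition Delta of cellular_system A I J D := fun l : L => {malg D l[I l]}.
Definition Deltaop of cellular_system A I J D := fun l : L => {malg D l[J l]}.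

HB.instance Definition _ c l := GRing.Zmodule.on (Delta c l).
HB.instance Definition _ c l := GRing.Zmodule.on (Deltaop c l).

End StandardModuleTypes.

Section StandardModules.
Variables (k : fieldType) (A : algType k).
Variables (d : Order.disp_t) (L : porderType d).
Variables (I J : L -> choiceType) (D : L -> algType k).
Variable c : cellular_system A I J D.
Variable l : L.

Local Notation Delta := (Delta c l).
Local Notation Deltaop := (Deltaop c l).

Definition Delta_a (i : I l) (x : D l) : Delta := << x *g i >>.
Definition Deltaop_b (j : J l) (x : D l) : Deltaop := << x *g j >>.

(* a . a_i(x) = sum_i' a_i'(f_i'(a, i) x) and b_j(x) . a = sum_j' b_j'(x g_j'(j, a)),
   extended additively. *)
Definition Delta_scale (a : A) (u : Delta) : Delta :=
  msum (fun i => malg_mulr (cell_f c a i)) u.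
Definition Deltaop_scale (a : A^c) (v : Deltaop) : Deltaop :=
  msum (fun j => malg_mull (cell_g c j a)) v.

Local Notation emb j := (msum (fun i => cell c i j)).
Local Notation embop i := (msum (fun j => cell c i j)).

Lemma emb_coord i j (u : Delta) : cell_coord c i j (emb j u) = mcoeff i u.
Proof.
move: u; apply: (malg_eq_additive (f := cell_coord c i j \o emb j)) => x i' /=.
by rewrite msumU cell_coord_cell eqxx andbT mcoeffU.
Qed.

Lemma embop_coord i j (v : Deltaop) : cell_coord c i j (embop i v) = mcoeff j v.
Proof.
move: v; apply: (malg_eq_additive (f := cell_coord c i j \o embop i)) => x j' /=.
by rewrite msumU cell_coord_cell eqxx mcoeffU.
Qed.

Lemma embop_coord_neq (i i1 : I l) (j : J l) (v : Deltaop) :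
  i != i1 -> cell_coord c i1 j (embop i v) = 0.
Proof.
move=> /negPf ne; rewrite (raddf_sum (cell_coord c i1 j)) big1 // => j1 _.
by rewrite /= cell_coord_cell ne.
Qed.

Lemma emb_scale a j (u : Delta) :
  cell_gt (cell c) l (a * emb j u - emb j (Delta_scale a u)).
Proof.
refine (cell_gt_malg (f := a \*o emb j)
  (g := emb j \o msum (fun i => malg_mulr (cell_f c a i))) _ u) => x i /=.
rewrite !msumU msum_malg_mulr; exact: cell_mull.
Qed.

Lemma embop_scale a i (v : Deltaop) :
  cell_gt (cell c) l (embop i v * a - embop i (Deltaop_scale a v)).
Proof.
refine (cell_gt_malg (f := (a : A) \o* embop i)
  (g := embop i \o msum (fun j => malg_mull (cell_g c j a))) _ v) => x j /=.
rewrite !msumU msum_malg_mull; exact: cell_mulr.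
Qed.

Lemma cell_coord_eq (i : I l) (j : J l) a b :
  cell_gt (cell c) l (a - b) -> cell_coord c i j a = cell_coord c i j b.
Proof. by move/(cell_coord_gt i j)/eqP; rewrite raddfB subr_eq0 => /eqP. Qed.

Lemma Delta_scaleE a i j u :
  mcoeff i (Delta_scale a u) = cell_coord c i j (a * emb j u).
Proof. by rewrite -(emb_coord i j) (cell_coord_eq _ _ (emb_scale a j u)). Qed.

Lemma Deltaop_scaleE a i j v :
  mcoeff j (Deltaop_scale a v) = cell_coord c i j (embop i v * a).
Proof. by rewrite -(embop_coord i j) (cell_coord_eq _ _ (embop_scale a i v)). Qed.

Fact Delta_scaleA a b u :
  Delta_scale a (Delta_scale b u) = Delta_scale (a * b) u.
Proof.
have [j] := cell_J0 c l; apply/malgP => i; rewrite !(Delta_scaleE _ i j) -mulrA.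
apply/esym/cell_coord_eq; rewrite -mulrBr; apply: cell_gtMl; exact: emb_scale.
Qed.
Fact Delta_scale1 : left_id 1 Delta_scale.
Proof.
have [j] := cell_J0 c l; move=> u; apply/malgP => i.
by rewrite (Delta_scaleE _ i j) mul1r emb_coord.
Qed.
Fact Delta_scaleDr : right_distributive Delta_scale +%R.
Proof. by move=> a u v; rewrite /Delta_scale raddfD. Qed.
Fact Delta_scaleDl u : {morph Delta_scale^~ u : a b / a + b}.
Proof.
have [j] := cell_J0 c l; move=> a b; apply/malgP => i.
by rewrite mcoeffD !(Delta_scaleE _ i j) mulrDl raddfD.
Qed.

HB.instance Definition _ := GRing.Zmodule_isLmodule.Build A Delta
  Delta_scaleA Delta_scale1 Delta_scaleDr Delta_scaleDl.

Fact Deltaop_scaleA (a b : A^c) v :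
  Deltaop_scale a (Deltaop_scale b v) = Deltaop_scale (a * b) v.
Proof.
have [i] := cell_I0 c l; apply/malgP => j; rewrite !(Deltaop_scaleE _ i j).
apply/esym/cell_coord_eq.
rewrite -[X in _ * X]/((b : A) * (a : A)) mulrA -mulrBl.
apply: cell_gtMr; exact: embop_scale.
Qed.
Fact Deltaop_scale1 : left_id 1 Deltaop_scale.
Proof.
have [i] := cell_I0 c l; move=> v; apply/malgP => j.
by rewrite (Deltaop_scaleE _ i j) mulr1 embop_coord.
Qed.
Fact Deltaop_scaleDr : right_distributive Deltaop_scale +%R.
Proof. by move=> a u v; rewrite /Deltaop_scale raddfD. Qed.
Fact Deltaop_scaleDl v : {morph Deltaop_scale^~ v : a b / a + b}.
Proof.
have [i] := cell_I0 c l; move=> a b; apply/malgP => j.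
by rewrite mcoeffD !(Deltaop_scaleE _ i j) mulrDr raddfD.
Qed.

HB.instance Definition _ := GRing.Zmodule_isLmodule.Build A^c Deltaop
  Deltaop_scaleA Deltaop_scale1 Deltaop_scaleDr Deltaop_scaleDl.

(* f^l(j, i'); such an element exists (cell_fJIP) and is unique (cell_fJI_uniq). *)
Definition cell_fJI (j : J l) (i' : I l) : D l :=
  xget 0 [set y | forall i j',
    cell_gt (cell c) l (cell c i j 1 * cell c i' j' 1 - cell c i j' y)]%classic.

Lemma cell_coord_mul1 (i i' : I l) (j j' : J l) (x y : D l) :
  cell_coord c i j' (cell c i j x * cell c i' j' y)
    = mcoeff i (cell_f c (cell c i j x) i') * y.
Proof.
have := Delta_scaleE (cell c i j x) i j' << y *g i' >>.
by rewrite msumU => <-; rewrite /Delta_scale msumU mcoeff_malg_mulr.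
Qed.

Lemma cell_coord_mul2 (i i' : I l) (j j' : J l) (x y : D l) :
  cell_coord c i j' (cell c i j x * cell c i' j' y)
    = x * mcoeff j' (cell_g c j (cell c i' j' y)).
Proof.
have := Deltaop_scaleE (cell c i' j' y) i j' << x *g j >>.
by rewrite msumU => <-; rewrite /Deltaop_scale msumU mcoeff_malg_mull.
Qed.

Lemma cell_mul_coord (i i' : I l) (j j' : J l) (x y : D l) :
  let P := cell c i j x * cell c i' j' y in
  cell_gt (cell c) l (P - cell c i j' (cell_coord c i j' P)).
Proof.
move=> P.
have H1 : cell_gt (cell c) l (P - emb j' (Delta_scale (cell c i j x) << y *g i' >>)).
  by have := emb_scale (cell c i j x) j' << y *g i' >>; rewrite msumU.
have H2 : cell_gt (cell c) l (P - embop i (Deltaop_scale (cell c i' j' y) << x *g j >>)).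
  by have := embop_scale (cell c i' j' y) i << x *g j >>; rewrite msumU.
suff <- : emb j' (Delta_scale (cell c i j x) << y *g i' >>)
          = cell c i j' (cell_coord c i j' P) by [].
rewrite -[RHS](msumU (fun i => cell c i j')); congr (msum _ _); apply/malgP => i1.
rewrite -(emb_coord i1 j') -(cell_coord_eq _ _ H1) mcoeffU.
case: eqP => [-> //|ne]; rewrite (cell_coord_eq _ _ H2) embop_coord_neq //.
by apply/eqP.
Qed.

Lemma cell_fJI_ex (j : J l) (i' : I l) : exists z : D l,
  forall i j' x y, cell_gt (cell c) l
    (cell c i j x * cell c i' j' y - cell c i j' (x * z * y)).
Proof.
have [i0] := cell_I0 c l; have [j0] := cell_J0 c l.
exists (cell_coord c i0 j0 (cell c i0 j 1 * cell c i' j0 1)) => i j' x y.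
suff -> : x * cell_coord c i0 j0 (cell c i0 j 1 * cell c i' j0 1) * y
          = cell_coord c i j' (cell c i j x * cell c i' j' y).
  exact: cell_mul_coord.
have -> : cell_coord c i j' (cell c i j x * cell c i' j' y)
          = x * cell_coord c i j' (cell c i j 1 * cell c i' j' y).
  by rewrite !cell_coord_mul2 mul1r.
have -> : cell_coord c i j' (cell c i j 1 * cell c i' j' y)
          = cell_coord c i j' (cell c i j 1 * cell c i' j' 1) * y.
  by rewrite !cell_coord_mul1 mulr1.
rewrite -mulrA; congr (_ * (_ * _)).
transitivity (cell_coord c i j0 (cell c i j 1 * cell c i' j0 1)).
  by rewrite !cell_coord_mul2.
by rewrite !cell_coord_mul1.
Qed.

Lemma cell_fJI_uniq (j : J l) (i' : I l) (z z' : D l) (i : I l) (j' : J l) :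
  cell_gt (cell c) l (cell c i j 1 * cell c i' j' 1 - cell c i j' z) ->
  cell_gt (cell c) l (cell c i j 1 * cell c i' j' 1 - cell c i j' z') -> z = z'.
Proof.
by move=> /(cell_coord_eq i j') + /(cell_coord_eq i j'); rewrite !cell_coord_id => ->.
Qed.

Lemma cell_fJIP j i' i j' x y :
  cell_gt (cell c) l
    (cell c i j x * cell c i' j' y - cell c i j' (x * cell_fJI j i' * y)).
Proof.
have [z Hz] := cell_fJI_ex j i'; suff -> : cell_fJI j i' = z by [].
have Hz1 : forall i j', cell_gt (cell c) l
    (cell c i j 1 * cell c i' j' 1 - cell c i j' z).
  by move=> i1 j1; have := Hz i1 j1 1 1; rewrite mul1r mulr1.
have := @xgetPex _ 0 [set y | forall i j',
  cell_gt (cell c) l (cell c i j 1 * cell c i' j' 1 - cell c i j' y)]%classic.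
move=> /(_ (ex_intro _ z Hz1)) H.
exact: cell_fJI_uniq (H i j') (Hz1 i j').
Qed.

Definition phi_form (v : Deltaop) (u : Delta) : D l :=
  \sum_(j <- msupp v) \sum_(i <- msupp u) v@_j * cell_fJI j i * u@_i.

Lemma phi_formE i j v u : phi_form v u = cell_coord c i j (embop i v * emb j u).
Proof.
rewrite mulr_suml raddf_sum; apply: eq_bigr => j' _.
rewrite mulr_sumr raddf_sum; apply: eq_bigr => i' _ /=.
by rewrite (cell_coord_eq _ _ (cell_fJIP j' i' i j _ _)) cell_coord_id.
Qed.

Fact phi_formDl v v' u : phi_form (v + v') u = phi_form v u + phi_form v' u.
Proof.
have [[i] [j]] := (cell_I0 c l, cell_J0 c l).
by rewrite !(phi_formE i j) raddfD mulrDl raddfD.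
Qed.

Fact phi_formDr v u u' : phi_form v (u + u') = phi_form v u + phi_form v u'.
Proof.
have [[i] [j]] := (cell_I0 c l, cell_J0 c l).
by rewrite !(phi_formE i j) raddfD mulrDr raddfD.
Qed.

Fact phi_formM v (a : A) u : phi_form ((a : A^c) *: v) u = phi_form v (a *: u).
Proof.
have [[i] [j]] := (cell_I0 c l, cell_J0 c l); rewrite !(phi_formE i j).
transitivity (cell_coord c i j (embop i v * a * emb j u)).
  by apply/esym/cell_coord_eq; rewrite -mulrBl; apply/cell_gtMr/embop_scale.
by apply: cell_coord_eq; rewrite -mulrA -mulrBr; apply/cell_gtMl/emb_scale.
Qed.

Definition phi : tensor Deltaop Delta -> D l := tensor_lift phi_form.

HB.instance Definition _ := GRing.isZmodMorphism.Build (tensor Deltaop Delta) (D l)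
  phi (tensor_liftB phi_formDl phi_formDr phi_formM).

Lemma phi_tens j x i y :
  phi (tens (Deltaop_b j x) (Delta_a i y)) = x * cell_fJI j i * y.
Proof.
rewrite /phi (tensor_lift_tens phi_formDl phi_formDr phi_formM).
have [[i0] [j0]] := (cell_I0 c l, cell_J0 c l).
rewrite (phi_formE i0 j0) !msumU (cell_coord_eq _ _ (cell_fJIP _ _ _ _ _ _)).
by rewrite cell_coord_id.
Qed.

End StandardModules.

Arguments phi {k A d L I J D} c l t.

Section Classes.
Variables (k : fieldType) (A : algType k).
Variables (d : Order.disp_t) (L : porderType d).
Variables (I J : L -> choiceType) (D : L -> algType k).
Implicit Type c : cellular_system A I J D.

Definition Lambda_irr c (l : L) : Prop := exists t, phi c l t <> 0.

Definition division_ring (R : nzRingType) : Prop :=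
  forall x : R, x != 0 -> exists y, y * x = 1 /\ x * y = 1.

Definition divisible c : Prop := forall l, division_ring (D l).

Definition full c : Prop := forall l (x : D l), exists t, phi c l t = x.

End Classes.

Definition has_irr_divisible_system (k : fieldType) (A : algType k) : Prop :=
  exists (d : Order.disp_t) (L : porderType d) (I J : L -> choiceType)
         (D : L -> algType k) (c : cellular_system A I J D),
    divisible c /\ forall l, Lambda_irr c l.

Definition has_full_divisible_system (k : fieldType) (A : algType k) : Prop :=
  exists (d : Order.disp_t) (L : porderType d) (I J : L -> choiceType)
         (D : L -> algType k) (c : cellular_system A I J D),
    full c /\ divisible c.

(* Main.v *)
Require Import Defs.
From HB Require Import structures.
From mathcomp Require Import all_boot all_order all_algebra all_field.
From mathcomp Require Import boolp.
From mathcomp Require Import finmap monalg zify.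

Set Implicit Arguments.
Unset Strict Implicit.
Unset Printing Implicit Defensive.

Import Order.TTheory GRing.Theory.
Local Open Scope ring_scope.

(** A cell of a divisible cellular system is a copy of a division ring D placed
    at position (i, j) of a matrix, and the heredity ideals of a quasi-hereditary
    algebra are exactly what such matrices of cells look like.

    Let H be a heredity ideal of a finite dimensional algebra B, and let e be a
    nonzero idempotent of H with B e as small as possible.  Since H rad(B) H = 0,
    no nonzero element of the corner e B e lies in the radical, and minimality
    then makes D = e B e a division ring (exists_division_corner).  Because H is
    projective, the multiplication map from the tensor product of B e and e B
    over D onto B e B is injective (corner_mul_free).  So, if the a_i form a
    D-basis of B e and the b_j one of e B, the maps sending x in D to a_i x b_j
    decompose B e B into cells; expanding v a_i and b_j v in these bases gives
    the two multiplication laws (exists_corner_layer).  Modulo B e B the ideal H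
    is again a heredity ideal, and iterating refines a heredity chain into a
    chain of ideals of A whose successive quotients are single matrices of cells
    (heredity_pair_step, quasi_hereditary_chain).  The point that needs care is
    the radical condition in a quotient: an element that generates a nil left
    ideal modulo K does so in A once it is corrected by an idempotent of K
    (nil_mod_ideal), so that the condition can be carried along in terms of the
    nil left ideals of A itself.  As a cellular system only asks for congruences
    modulo the larger labels, arbitrary linear lifts to A of these cells form a
    system whose labels are the members of the chain (layer_chain_system).

    Conversely, in a cellular system of A the cells whose labels lie in an
    up-closed set span a two-sided ideal.  There are finitely many labels, and
    adding them one at a time along a linear extension of the reversed order
    gives a chain of ideals.  Let l be the label added at some step, with
    f(j0, i0) invertible in D(l) and inverse z.  Modulo the previous ideal, all
    the columns of the matrix of cells of l are isomorphic as left modules, right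
    multiplication by c_{i0,j}(z) carries column j0 to column j, and
    c_{i0,j0}(z) is idempotent.  This yields idempotence and projectivity.  A
    product c_{i,j}(x) r c_{i',j'}(x') is congruent to c_{i,j'}(x y x') where y
    depends on j, r and i' only; if y were nonzero it would be invertible, and r
    would be a factor of the nonzero idempotent c_{i0,j0}(z), which is impossible
    for r in the radical (jacobson_idempotent_factor, cell_ideal_heredity).

    Finally the image of phi is a two-sided ideal of D(l), so over a division
    ring it is everything as soon as it is nonzero (irr_divisible_full). *)

(** * Nil left ideals and idempotents *)

Lemma exists_argmax (T : Type) (P : T -> Prop) (d : T -> nat) (N : nat) :
  (exists x, P x) -> (forall x, P x -> (d x <= N)%N) ->
  exists x, P x /\ forall y, P y -> (d y <= d x)%N.
Proof.
move=> [x0 Px0] dN; pose p n := `[< exists x, P x /\ d x = n >].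
have ex : exists n, p n by exists (d x0); apply/asboolP; exists x0.
have bd n : p n -> (n <= N)%N by move=> /asboolP[x [Px <-]]; apply: dN.
case: (ex_maxnP ex bd) => _ /asboolP[x [Px <-]] H; exists x; split=> // y Py.
by apply: H; apply/asboolP; exists y.
Qed.

Lemma exists_argmin (T : Type) (P : T -> Prop) (d : T -> nat) :
  (exists x, P x) -> exists x, P x /\ forall y, P y -> (d x <= d y)%N.
Proof.
move=> [x0 Px0]; pose p n := `[< exists x, P x /\ d x = n >].
have ex : exists n, p n by exists (d x0); apply/asboolP; exists x0.
case: (ex_minnP ex) => _ /asboolP[x [Px <-]] H; exists x; split=> // y Py.
by apply: H; apply/asboolP; exists y.
Qed.

Section Idempotents.
Variables (k : fieldType) (A : falgType k).
Implicit Types (x y e f : A) (U K H : {vspace A}).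

Definition two_sided U := forall a x, x \in U -> a * x \in U /\ x * a \in U.

Definition nil_left_ideal x := forall a, exists n, (a * x) ^+ n = 0.

Lemma poly_annihilator y : exists2 p : {poly k}, p != 0 & horner_alg y p = 0.
Proof.
pose X := [tuple y ^+ i | i < (\dim {:A}).+1].
have nfX : ~~ free X.
  apply/negP; rewrite /free size_tuple => /eqP e.
  by have := dimvS (subvf <<X>>%VS); rewrite e ltnn.
have [c [c0 [i0 /eqP ci0]]] : exists c : 'I_(\dim {:A}).+1 -> k,
    \sum_i c i *: X`_i = 0 /\ exists i, c i <> 0.
  apply: contrapT => H; move/negP: nfX; apply; apply/freeP => c c0 i.
  by apply: contrapT => ci; apply: H; exists c; split=> //; exists i.
exists (\poly_(i < (\dim {:A}).+1) c (inord i)).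
  apply/eqP => /(congr1 (fun p : {poly k} => p`_i0)).
  by rewrite coef0 coef_poly ltn_ord inord_val; apply/eqP.
rewrite poly_def raddf_sum -[RHS]c0; apply: eq_bigr => i _.
rewrite [LHS]linearZ /= rmorphXn /= horner_algX inord_val.
by rewrite -(tnth_nth 0 X) tnth_mktuple mulr_algl.
Qed.

(** Fitting's lemma for right multiplication by y: f is the projection onto the
    part of the algebra where y acts invertibly, and it lies in the left ideal of
    y because that part is the image of a power of y. *)
Lemma fitting_idempotent y : exists q n,
  let f := q * y in f * f = f /\ f * y ^+ n = y ^+ n.
Proof.
have [p p0 yp] := poly_annihilator y.
have [n [q nr pE]] := multiplicity_XsubC p 0; rewrite p0 /= in nr.
move: pE; rewrite subr0 => pE.
pose a := q`_0; have a0 : a != 0 by move: nr; rewrite /root horner_coef0.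
(* The annihilating polynomial is (a - a X r) X^n with a != 0, so that
   y^n = y^(n+1) r(y); iterating, y^n = y^(2n+1) r(y)^(n+1). *)
pose r := - a^-1 *: drop_poly 1 q; pose h := horner_alg y.
have hM u v : h (u * v) = h u * h v by exact: rmorphM.
have qE : q = a%:P + drop_poly 1 q * 'X.
  rewrite -[LHS](poly_take_drop 1) expr1; congr (_ + _).
  by apply/polyP=> i; rewrite coef_take_poly coefC; case: i.
have yn : h 'X^n = h ('X^(n.+1) * r).
  apply/eqP; rewrite -subr_eq0 -rmorphB; apply/eqP.
  suff -> : 'X^n - 'X^(n.+1) * r = a^-1 *: p by rewrite /h [LHS]linearZ /= yp mulr0.
  rewrite pE [in RHS]qE mulrDl scalerDr mul_polyC scalerA mulVf // scale1r /r.
  rewrite scaleNr mulrN opprK -scalerAr exprS; congr (_ + _ *: _).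
  by rewrite mulrC -!mulrA.
have ynm m : h 'X^n = h ('X^(n + m) * r ^+ m).
  elim: m => [|m IH]; first by rewrite addn0 mulr1.
  have -> : 'X^(n + m.+1) * r ^+ m.+1 = 'X^m * r ^+ m * ('X^(n.+1) * r).
    rewrite addnC addSnnS exprD [r ^+ _]exprSr !mulrA; congr (_ * _).
    exact: mulrAC.
  rewrite hM -yn -hM IH; congr (h _).
  by rewrite mulrAC -exprD addnC.
have fE : h (r ^+ n.+1 * 'X^n) * y = h (r ^+ n.+1 * 'X^(n.+1)).
  by rewrite -{1}[y]horner_algX -hM -mulrA -exprSr.
have ynE : y ^+ n = h 'X^n by rewrite /h [RHS]rmorphXn /= horner_algX.
exists (h (r ^+ n.+1 * 'X^n)), n; rewrite /= fE ynE -!hM; split.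
  have -> : r ^+ n.+1 * 'X^(n.+1) * (r ^+ n.+1 * 'X^(n.+1))
      = (r ^+ n.+1 * 'X) * ('X^(n + n.+1) * r ^+ n.+1).
    rewrite -!mulrA; congr (_ * _).
    by rewrite [r ^+ _ * _]mulrC !mulrA -exprD -exprS addSn.
  by rewrite hM -ynm -hM -mulrA -exprS.
by rewrite [RHS](ynm n.+1) -mulrA -exprD addnC mulrC.
Qed.

Lemma memv_principalP f x : reflect (exists a, x = a * f) (x \in limg (amulr f)).
Proof.
apply: (iffP memv_imgP) => [[a _ ->]|[a ->]]; first by exists a; rewrite lfunE.
by exists a; rewrite ?memvf // lfunE.
Qed.

Lemma principalS e f : (exists a, f = a * e) -> (limg (amulr f) <= limg (amulr e))%VS.
Proof.
move=> [a ->]; apply/subvP => _ /memv_principalP[b ->].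
by apply/memv_principalP; exists (b * a); rewrite mulrA.
Qed.

Lemma idempotentX f n : f * f = f -> f ^+ n.+1 = f.
Proof. by move=> ff; elim: n => [|n IH]; rewrite ?expr1 // exprS IH. Qed.

(** Choose f idempotent in A x with A f maximal.  It is its own power, hence in K.
    A nonzero idempotent g in A x (1 - f) would satisfy g f = 0, and f could be
    enlarged to f + (1 - f) g; so by Fitting's lemma A x (1 - f) is nil.  This is
    the statement that the radical of A / K is the image of the radical of A. *)
Lemma nil_mod_ideal K x : two_sided K ->
  (forall a, exists n, (a * x) ^+ n \in K) ->
  exists2 f, f \in K & nil_left_ideal (x * (1 - f)).
Proof.
move=> Kid nK.
pose P f := f * f = f /\ exists a, f = a * x.
have [||f [[ff [b fE]] fmax]] :=
  @exists_argmax _ P (fun f => \dim (limg (amulr f))) (\dim {:A}).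
- by exists 0; split; [rewrite mul0r | exists 0; rewrite mul0r].
- by move=> f _; apply: dimvS (subvf _).
have f1 : f * (1 - f) = 0 by rewrite mulrBr mulr1 ff subrr.
have f2 : (1 - f) * f = 0 by rewrite mulrBl mul1r ff subrr.
exists f.
  have [n] := nK b; rewrite -fE; case: n => [|n]; last by rewrite idempotentX.
  by rewrite expr0 => K1; rewrite -[f]mulr1; case: (Kid f 1 K1).
move=> a; have [q [n [/= gg gn]]] := fitting_idempotent (a * (x * (1 - f))).
set g := q * _ in gg gn; suff g0 : g = 0 by exists n; rewrite -gn g0 mul0r.
have gf : g * f = 0 by rewrite /g -!mulrA f2 !mulr0.
pose f' := f + (1 - f) * g.
have ff' : f * f' = f by rewrite /f' mulrDr ff mulrA f1 mul0r addr0.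
have g1 : g * (1 - f) = g by rewrite mulrBr mulr1 gf subr0.
have gf' : g * f' = g by rewrite /f' mulrDr gf add0r mulrA g1.
have Pf' : P f'.
  split; first by rewrite {1}/f' mulrDl ff' -mulrA gf'.
  exists (b + (1 - f) * (q * (a * (1 - x * b)))).
  rewrite /f' /g [RHS]mulrDl -fE; congr (_ + _); rewrite -!mulrA; congr (_ * (_ * (_ * _))).
  by rewrite fE mulrBr mulrBl mul1r mulr1 !mulrA.
apply/eqP; apply: contraT => gn0.
have := fmax _ Pf'; rewrite leqNgt => /negP[].
have sub : (limg (amulr f) <= limg (amulr f'))%VS.
  by apply: principalS; exists f.
rewrite ltn_neqAle (dimvS sub) andbT; apply/negP => /eqP ed.
have /eqP E : limg (amulr f) == limg (amulr f') by rewrite eqEdim sub ed /=.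
have : g \in limg (amulr f) by rewrite E; apply/memv_principalP; exists g.
by case/memv_principalP=> c gE; case/eqP: gn0; rewrite -g1 gE -mulrA f1 mulr0.
Qed.

(** For finite dimensional algebras the x with B x nil are those of the Jacobson
    radical, so this is the condition H rad(B) H = 0. *)
Definition radical_kills H := forall x, nil_left_ideal x ->
  forall u v, u \in H -> v \in H -> u * x * v = 0.

(** The corner e B e is a division ring with unit e. *)
Definition division_corner e :=
  forall x, e * x * e = x -> x != 0 ->
  exists y, [/\ e * y * e = y, y * x = e & x * y = e].

(** H contains a nonzero idempotent, since otherwise all its elements would
    generate nil left ideals and H = H H H would vanish.  Take e with B e minimal:
    for x nonzero in e B e, the left ideal B x is not nil, hence contains a nonzero
    idempotent f, and B f = B e forces e into B x. *)
Lemma exists_division_corner H : two_sided H -> (H <= H * H)%VS ->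
  radical_kills H -> H != 0%VS ->
  exists e, [/\ e \in H, e * e = e, e != 0 & division_corner e].
Proof.
move=> Hid HH radH nzH.
pose P e := [/\ e \in H, e * e = e & e != 0].
have fitP x : ~ nil_left_ideal x -> exists q, let f := q * x in f * f = f /\ f != 0.
  move=> /existsNP[a na]; have [q [n [/= ff fn]]] := fitting_idempotent (a * x).
  exists (q * a); rewrite [q * (a * x)]mulrA in ff fn; split; first exact: ff.
  by apply/eqP => f0; apply: na; exists n; rewrite -fn f0 mul0r.
have exP : exists e, P e.
  apply: contrapT => nP.
  have nH x : x \in H -> nil_left_ideal x.
    move=> Hx; apply: contrapT => /fitP[q [/= ff f0]]; apply: nP.
    by exists (q * x); split=> //; case: (Hid q x Hx).
  apply: (negP nzH); rewrite -subv0.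
  have HHH : (H * H * H <= 0)%VS.
    apply/prodvP => w v HHw Hv; rewrite memv0.
    have /subvP/(_ w HHw) : (H * H <= lker (amulr v))%VS.
      apply/prodvP => u x Hu Hx; rewrite memv_ker lfunE /=.
      by rewrite (radH x (nH x Hx)).
    by rewrite memv_ker lfunE.
  exact: subv_trans HH (subv_trans (prodvSl _ HH) HHH).
have [e [[He ee e0] emin]] := exists_argmin (fun e => \dim (limg (amulr e))) exP.
have left_inv x : e * x * e = x -> x != 0 -> exists2 y, e * y * e = y & y * x = e.
  move=> xE x0.
  have /fitP[q [ff f0]] : ~ nil_left_ideal x.
    by move=> nx; case/eqP: x0; rewrite -xE (radH x nx).
  set f := q * x in ff f0.
  have fe : f * e = f by rewrite /f -xE -!mulrA ee.
  have Hf : f \in H by rewrite -fe; case: (Hid f e He).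
  have sub : (limg (amulr f) <= limg (amulr e))%VS by apply: principalS; exists f.
  have /eqP E : limg (amulr f) == limg (amulr e) by rewrite eqEdim sub emin.
  have : e \in limg (amulr f) by rewrite E; apply/memv_principalP; exists e.
  case/memv_principalP=> b eE; exists (e * (b * q) * e).
    by rewrite !mulrA ee -!mulrA ee.
  have ex : e * x = x by rewrite -xE !mulrA ee.
  by rewrite -!mulrA ex -/f -eE ee.
exists e; split=> // x xE x0; have [y yE yx] := left_inv x xE x0.
have y0 : y != 0 by apply: contra_eq_neq yx => ->; rewrite mul0r eq_sym.
have [z zE zy] := left_inv y yE y0; exists y; split=> //.
have <- : z = x; last by [].
have ex : e * x = x by rewrite -xE !mulrA ee.
have ze : z * e = z by rewrite -zE -!mulrA ee.
by rewrite -[LHS]ze -yx mulrA zy.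
Qed.

End Idempotents.

(** * Quotient algebras and corner algebras *)

(** The quotient algebra is nontrivial only when 1 is outside the ideal. *)
Record proper_ideal (k : fieldType) (A : falgType k) := ProperIdeal {
  proper_ideal_vspace :> {vspace A};
  proper_ideal_two_sided : two_sided proper_ideal_vspace;
  proper_ideal1 : 1 \notin proper_ideal_vspace
}.

Section QuotientAlgebra.
Variables (k : fieldType) (A : falgType k) (K : proper_ideal A).

(** A linear complement of K, multiplied by projecting along K, is a finite
    dimensional vector space by construction. *)
Definition quotient_algebra : Type := subvs_of (K^C)%VS.
HB.instance Definition _ := Vector.on quotient_algebra.

Definition quotient_map (a : A) : quotient_algebra :=
  vsproj (K^C)%VS (daddv_pi (K^C) K a).

Fact quotient_map_linear : linear quotient_map.
Proof. by move=> c a b; rewrite /quotient_map !linearP. Qed.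

HB.instance Definition _ := GRing.isLinear.Build k A quotient_algebra *:%R
  quotient_map quotient_map_linear.

Let capK : (K^C :&: K = 0)%VS. Proof. by rewrite capvC capv_compl. Qed.

Lemma quotient_mapK (b : quotient_algebra) : quotient_map (val b) = b.
Proof. by rewrite /quotient_map daddv_pi_id ?subvsP //; apply: vsvalK. Qed.

Lemma sub_quotient_map_mem a : a - val (quotient_map a) \in proper_ideal_vspace K.
Proof.
rewrite /quotient_map /= vsprojK ?memv_pi //.
have e : daddv_pi (K^C) K a + daddv_pi K (K^C) a = a.
  by apply: daddv_pi_add => //; rewrite addvC addv_complf memvf.
by rewrite -{1}e addrC addKr memv_pi.
Qed.

Lemma quotient_map_eq0 a : (quotient_map a == 0) = (a \in proper_ideal_vspace K).
Proof.
have := sub_quotient_map_mem a; have [->|a0] := eqVneq (quotient_map a) 0.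
  by rewrite (_ : val 0 = 0) ?subr0 ?linear0 // => ->.
move=> Ka; apply/esym/negbTE; apply: contraNN a0 => Ka'.
suff : val (quotient_map a) \in (K^C :&: K)%VS by rewrite capK memv0.
by rewrite memv_cap subvsP /= -[vsval _](subKr a) rpredB.
Qed.

Lemma quotient_map_eq a b :
  a - b \in proper_ideal_vspace K -> quotient_map a = quotient_map b.
Proof. by rewrite -quotient_map_eq0 raddfB subr_eq0 => /eqP. Qed.

Definition quotient_one := quotient_map 1.
Definition quotient_mul (x y : quotient_algebra) := quotient_map (val x * val y).

Lemma quotient_mapM a b :
  quotient_map (a * b) = quotient_mul (quotient_map a) (quotient_map b).
Proof.
apply: quotient_map_eq; set a' := val _; set b' := val _.
rewrite -(subrK (a' * b) (a * b)) -addrA -mulrBl -mulrBr.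
have [Ka Kb] := (sub_quotient_map_mem a, sub_quotient_map_mem b).
have [_ KaM] := proper_ideal_two_sided b Ka.
by have [KbM _] := proper_ideal_two_sided a' Kb; rewrite rpredD.
Qed.

Fact quotient_mulA : associative quotient_mul.
Proof.
move=> x y z; rewrite -[x]quotient_mapK -[y]quotient_mapK -[z]quotient_mapK.
by rewrite -!quotient_mapM mulrA.
Qed.
Fact quotient_mul1l : left_id quotient_one quotient_mul.
Proof. by move=> x; rewrite -[x]quotient_mapK -quotient_mapM mul1r. Qed.
Fact quotient_mul1r : right_id quotient_one quotient_mul.
Proof. by move=> x; rewrite -[x]quotient_mapK -quotient_mapM mulr1. Qed.
Fact quotient_mulDl : left_distributive quotient_mul +%R.
Proof. by move=> x y z; rewrite /quotient_mul !raddfD mulrDl raddfD. Qed.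
Fact quotient_mulDr : right_distributive quotient_mul +%R.
Proof. by move=> x y z; rewrite /quotient_mul !raddfD mulrDr raddfD. Qed.
Fact quotient_one_neq0 : quotient_one != 0.
Proof. by rewrite quotient_map_eq0 proper_ideal1. Qed.

HB.instance Definition _ := GRing.Zmodule_isNzRing.Build quotient_algebra
  quotient_mulA quotient_mul1l quotient_mul1r quotient_mulDl quotient_mulDr
  quotient_one_neq0.

Fact quotient_scaleAl (c : k) (x y : quotient_algebra) :
  c *: (x * y) = (c *: x) * y.
Proof. by rewrite /GRing.mul /= /quotient_mul !linearZ /= -scalerAl linearZ. Qed.
HB.instance Definition _ := GRing.Lmodule_isLalgebra.Build k quotient_algebra
  quotient_scaleAl.

Fact quotient_scaleAr (c : k) (x y : quotient_algebra) :
  c *: (x * y) = x * (c *: y).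
Proof. by rewrite /GRing.mul /= /quotient_mul !linearZ /= -scalerAr linearZ. Qed.
HB.instance Definition _ := GRing.Lalgebra_isAlgebra.Build k quotient_algebra
  quotient_scaleAr.

HB.instance Definition _ := Algebra_isFalgebra.Build k quotient_algebra.

End QuotientAlgebra.

Lemma exists_quotient_algebra (k : fieldType) (A : falgType k) (K : {vspace A}) :
  two_sided K -> 1 \notin K ->
  exists (B : falgType k) (p : {linear A -> B}) (s : {linear B -> A}),
    [/\ p 1 = 1, forall a b, p (a * b) = p a * p b, cancel s p
      & forall a, (p a == 0) = (a \in K)].
Proof.
move=> Kid K1; pose Q := ProperIdeal Kid K1.
exists (quotient_algebra Q), (@quotient_map _ _ Q).
exists (vsval : quotient_algebra Q -> A).
split=> //; [exact: quotient_mapM | exact: quotient_mapK | exact: quotient_map_eq0].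
Qed.

(** Gaussian elimination over a division ring, for both left and right modules:
    op d v stands for either d v or v d, and the identity u of D may act as an
    idempotent, the module being its image.  A spanning list is thinned out from
    the tail, keeping a vector when it is not in the span of those kept so far. *)
Lemma division_basis (k : fieldType) (D : lmodType k) (V : vectType k)
    (op : D -> V -> V) (u : D) :
  (forall v, linear (op^~ v)) -> (forall d, linear (op d)) ->
  (forall d d', exists d'', forall v, op d (op d' v) = op d'' v) ->
  (forall d, d != 0 -> exists d', forall v, op d' (op d v) = op u v) ->
  (forall v, op u (op u v) = op u v) ->
  exists n (b : 'I_n -> V),
    [/\ forall i, op u (b i) = b i,
        forall v, exists d, op u v = \sum_i op (d i) (b i)
      & forall d, \sum_i op (d i) (b i) = 0 -> forall i, d i = 0].
Proof.
move=> linl linr opM opV opu.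
have op0 v : op 0 v = 0.
  by have := linl v (-1) 0 0; rewrite scaleN1r oppr0 addr0 scaleN1r addNr.
have opr0 d : op d 0 = 0.
  by have := linr d (-1) 0 0; rewrite scaleN1r oppr0 addr0 scaleN1r addNr.
have oprD d v w : op d (v + w) = op d v + op d w by have := linr d 1 v w; rewrite !scale1r.
have oprS d (I : finType) (F : I -> V) : op d (\sum_i F i) = \sum_i op d (F i).
  by apply: (big_morph (op d)).
have step (s : seq V) : exists n (b : 'I_n -> V),
    [/\ forall i, op u (b i) = b i,
        forall v, v \in s -> exists d, op u v = \sum_i op (d i) (b i)
      & forall d, \sum_i op (d i) (b i) = 0 -> forall i, d i = 0].
  elim: s => [|v s [n [b [ub sb fb]]]].
    by exists 0, (fun=> 0); split=> [[]||d _ []] //.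
  have [vb|nvb] := pselect (exists d, op u v = \sum_i op (d i) (b i)).
    exists n, b; split=> // w; rewrite inE => /orP[/eqP-> //|]; exact: sb.
  exists n.+1, (fun i => oapp b (op u v) (unlift ord0 i)); split.
  - by move=> i; case: unliftP => [j|] _ /=; rewrite ?ub ?opu.
  - move=> w; rewrite inE => /orP[/eqP->|/sb[d wE]].
      exists (fun i => oapp (fun=> 0) u (unlift ord0 i)).
      rewrite big_ord_recl unlift_none /= opu big1 ?addr0 // => i _.
      by rewrite liftK /= op0.
    exists (fun i => oapp d 0 (unlift ord0 i)).
    rewrite big_ord_recl unlift_none /= op0 add0r wE.
    by apply: eq_bigr => i _; rewrite liftK.
  - move=> d; rewrite big_ord_recl unlift_none /=.
    under eq_bigr do rewrite liftK /=.
    have [d0|d0] := eqVneq (d ord0) 0.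
      rewrite d0 op0 add0r => /fb db i.
      by case: (unliftP ord0 i) => [j ->|-> //]; apply: db.
    move=> e; case: nvb; have [d' dV] := opV _ d0.
    have dM i : exists d'', forall v, op d' (op (d (lift ord0 i)) v) = op d'' v := opM _ _.
    have [dd ddE] := choice dM.
    exists (fun i => - dd i).
    move/(congr1 (op d')): e; rewrite opr0 oprD dV opu oprS => /eqP.
    rewrite addr_eq0 => /eqP ->; rewrite -sumrN; apply: eq_bigr => i _.
    rewrite ddE; have := linl (b i) (-1) (dd i) 0.
    by rewrite op0 !addr0 !scaleN1r.
have [n [b [ub sb fb]]] := step (vbasis {:V}); exists n, b; split=> // v.
have vbm (i : 'I_(\dim {:V})) : exists d, op u (vbasis {:V})`_i = \sum_j op (d j) (b j).
  by apply: sb; apply: mem_nth; rewrite size_tuple.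
have [dd ddE] := choice vbm.
exists (fun j => \sum_i coord (vbasis {:V}) i v *: dd i j).
rewrite {1}(coord_vbasis (memvf v)) oprS.
have oprZ d c w : op d (c *: w) = c *: op d w by have := linr d c w 0; rewrite opr0 !addr0.
have oplZ d c w : op (c *: d) w = c *: op d w by have := linl w c d 0; rewrite op0 !addr0.
have oplS w (I : finType) (F : I -> D) : op (\sum_i F i) w = \sum_i op (F i) w.
  apply: (big_morph (op^~ w)) => // d d'.
  by have := linl w 1 d d'; rewrite !scale1r.
transitivity (\sum_i \sum_j coord (vbasis {:V}) i v *: op (dd i j) (b j)).
  by apply: eq_bigr => i _; rewrite oprZ ddE scaler_sumr.
rewrite exchange_big; apply: eq_bigr => j _; rewrite oplS.
by apply: eq_bigr => i _; rewrite oplZ.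
Qed.

Lemma exists_corner_algebra (k : fieldType) (B : falgType k) (e : B) :
  e * e = e -> e != 0 ->
  exists (D : falgType k) (h : {linear D -> B}),
    [/\ injective h, h 1 = e, forall x y, h (x * y) = h x * h y
      & forall x, e * x * e = x -> exists d, h d = x].
Proof.
move=> ee e0; pose C := limg (amulr e \o amull e).
have CP x : reflect (e * x * e = x) (x \in C).
  apply: (iffP memv_imgP) => [[y _ ->]|<-].
    by rewrite comp_lfunE !lfunE /= !mulrA ee -!mulrA ee.
  by exists x; rewrite ?memvf // comp_lfunE !lfunE.
have Cx x : x \in C -> e * x = x /\ x * e = x.
  by move/CP <-; rewrite !mulrA ee -!mulrA ee.
have eC : e \in C by apply/CP; rewrite !ee.
have algC : is_aspace C.
  apply/andP; split; first by apply/has_algidP; exists e; split.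
  apply/prodvP => x y Hx Hy; apply/CP.
  by rewrite -!mulrA (Cx y Hy).2 mulrA (Cx x Hx).1.
pose AC := ASpace algC.
exists (subvs_of AC), (vsval : subvs_of AC -> B); split=> //.
- exact: val_inj.
- by rewrite -[LHS](Cx _ (memv_algid AC)).2; exact: (@algidl _ _ AC _ eC).
- by move=> x /CP Cx'; exists (Subvs (Cx' : x \in AC)).
Qed.

(** * Matrices of cells in a heredity ideal *)

Section DualBasis.
Variables (k : fieldType) (A : falgType k).
Implicit Types (K H : {vspace A}).

(** The dual basis form of the projectivity of H / K over A / K, with the
    homomorphisms represented by maps defined on A. *)
Definition dual_basis_mod K H := exists (N : nat) (F : 'I_N -> A -> A) (q : 'I_N -> A),
  [/\ forall t, q t \in H,
      forall t x y, x \in H -> y \in H -> F t (x + y) - (F t x + F t y) \in K,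
      forall t a x, x \in H -> F t (a * x) - a * F t x \in K,
      forall t x, x \in K -> F t x \in K
    & forall x, x \in H -> x - \sum_t F t x * q t \in K].

(** Injectivity of the multiplication from the tensor product of B e and e B over
    e B e: coefficients in B e are determined by a combination of vectors of e B
    that are independent over e B e.  The projectivity of H provides homomorphisms
    x |-> F_t(x) y e from H to B e that separate the points of e B: if b in e B has
    F_t(b) B e = 0 for every t, then the F_t(b) = e F_t(b) generate nil left ideals,
    and b, which is the sum of the e F_t(b) q_t, lies in H rad(B) H = 0.
    Normalizing such a homomorphism to take the value e on the first vector
    eliminates that vector. *)
Lemma corner_mul_free H e : two_sided H -> radical_kills H -> dual_basis_mod 0 H ->
  e \in H -> e * e = e -> e != 0 -> division_corner e ->
  forall n (b : 'I_n -> A), (forall i, e * b i = b i) ->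
  (forall d : 'I_n -> A, (forall i, e * d i * e = d i) ->
     \sum_i d i * b i = 0 -> forall i, d i = 0) ->
  forall u : 'I_n -> A, (forall i, u i * e = u i) ->
  \sum_i u i * b i = 0 -> forall i, u i = 0.
Proof.
move=> Hid radH [N [F [q [qH FD FM _ Fq]]]] He ee e0 divE.
have {}FD t x y : x \in H -> y \in H -> F t (x + y) = F t x + F t y.
  by move=> Hx Hy; apply/eqP; rewrite -subr_eq0 -memv0 FD.
have {}FM t a x : x \in H -> F t (a * x) = a * F t x.
  by move=> Hx; apply/eqP; rewrite -subr_eq0 -memv0 FM.
have {}Fq x : x \in H -> x = \sum_t F t x * q t.
  by move=> Hx; apply/eqP; rewrite -subr_eq0 -memv0 Fq.
have FS t n (a : 'I_n -> A) (x : 'I_n -> A) : (forall i, x i \in H) ->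
    F t (\sum_i a i * x i) = \sum_i a i * F t (x i).
  move=> Hx.
  have F0 : F t 0 = 0 by rewrite -{1}(mul0r e) FM // mul0r.
  apply: (@proj2 (\sum_i a i * x i \in H)).
  apply: (big_ind2 (fun v w => v \in H /\ F t v = w)).
  - by rewrite mem0v.
  - by move=> v1 w1 v2 w2 [H1 <-] [H2 <-]; rewrite rpredD ?FD.
  - by move=> i _; have [Hax _] := Hid (a i) (x i) (Hx i); rewrite FM.
have bH n (b : 'I_n -> A) : (forall i, e * b i = b i) -> forall i, b i \in H.
  by move=> eb i; rewrite -eb; case: (Hid (b i) e He).
elim=> [|n IH] b eb fb u ue ub; first by case.
have b0 : b ord0 != 0.
  apply/eqP => b0; case/eqP: e0.
  pose d (i : 'I_n.+1) := if i == ord0 then e else 0.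
  suff /(_ ord0) : forall i, d i = 0 by [].
  apply: fb => [i|]; rewrite /d; first by case: eqP; rewrite ?ee // mulr0 mul0r.
  by rewrite big1 // => i _; case: eqP => [->|]; rewrite ?b0 ?mulr0 ?mul0r.
have [t [y ty]] : exists t y, F t (b ord0) * y * e != 0.
  apply: contrapT => Hn; case/eqP: b0; rewrite (Fq _ (bH _ _ eb _)) big1 // => t _.
  rewrite -eb FM; last exact: bH.
  apply: (radH _ _ e (q t) He (qH t)) => a; exists 2%N.
  have gae : F t (b ord0) * a * e = 0.
    by apply/eqP/negPn/negP => H0; apply: Hn; exists t, a.
  rewrite expr2 -!mulrA [X in a * X](_ : _ = 0) ?mulr0 //.
  rewrite -{2}[b ord0]eb FM; last exact: bH.
  by rewrite !mulrA gae mul0r.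
(* th is a left linear map on H with th (b ord0) = e, and s i are the
   coefficients used to subtract multiples of b ord0 from the other vectors. *)
pose th0 x := F t x * y * e.
have th0c x : x \in H -> e * x = x -> e * th0 x * e = th0 x.
  by move=> Hx ex; rewrite /th0 -{2}ex FM // !mulrA -mulrA ee.
have [z [ze _ z0]] := divE _ (th0c _ (bH _ _ eb ord0) (eb ord0)) ty.
pose th x := th0 x * z.
have thb0 : th (b ord0) = e by [].
pose s (i : 'I_n) := th (b (lift ord0 i)).
have se i : e * s i * e = s i.
  rewrite /s /th -(th0c _ (bH _ _ eb _) (eb _)) -ze !mulrA ee; do 4!rewrite -!mulrA ?ee //.
have es i : e * s i = s i by rewrite -se !mulrA ee.
have sE i : s i * e = s i by rewrite -se -!mulrA ee.
have thS m (a x : 'I_m -> A) : (forall i, x i \in H) ->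
    th (\sum_i a i * x i) = \sum_i a i * th (x i).
  move=> Hx; rewrite /th /th0 FS // !mulr_suml.
  by apply: eq_bigr => i _; rewrite -!mulrA.
have su : u ord0 + \sum_i u (lift ord0 i) * s i = 0.
  have F0 : F t 0 = 0 by rewrite -{1}(mul0r e) FM // mul0r.
  have : th 0 = 0 by rewrite /th /th0 F0 !mul0r.
  rewrite -{1}ub thS; last exact: bH.
  by rewrite big_ord_recl thb0 ue.
have ebs i : e * (b (lift ord0 i) - s i * b ord0) = b (lift ord0 i) - s i * b ord0.
  by rewrite mulrBr eb mulrA es.
have us i : u (lift ord0 i) = 0.
  apply: (IH (fun i => b (lift ord0 i) - s i * b ord0) ebs _
    (fun i => u (lift ord0 i))) => //.
    move=> d de; under eq_bigr do rewrite mulrBr mulrA.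
    rewrite sumrB -mulr_suml => db j.
    pose d' i := oapp d (- \sum_i d i * s i) (unlift ord0 i).
    have -> : d j = d' (lift ord0 j) by rewrite /d' liftK.
    apply: fb => [i'|].
      rewrite /d'; case: unliftP => [i0|] _ /=; first exact: de.
      rewrite mulrN mulNr mulr_sumr mulr_suml; congr (- _); apply: eq_bigr => l _.
      have ed : e * d l = d l by rewrite -de !mulrA ee.
      by rewrite mulrA ed -[_ * _ * e]mulrA sE.
    rewrite big_ord_recl {1}/d' unlift_none /= mulNr addrC -[RHS]db; congr (_ - _).
    by apply: eq_bigr => l _; rewrite /d' liftK.
  under eq_bigr do rewrite mulrBr mulrA.
  rewrite sumrB -mulr_suml -(mulN1r (_ * b _)) mulrA mulN1r.
  move/eqP: su; rewrite eq_sym -subr_eq sub0r => /eqP->.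
  by rewrite addrC -[RHS]ub big_ord_recl.
move=> i; case: (unliftP ord0 i) => [l ->|->]; first exact: us.
by move: su; rewrite big1 ?addr0 // => l _; rewrite us mul0r.
Qed.

End DualBasis.

(** K' / K is a single matrix of cells over a division algebra.  The last field says
    that phi is nonzero. *)
Record cell_layer (k : fieldType) (A : falgType k) (K K' : {vspace A}) := CellLayer {
  layer_alg : algType k;
  layer_rows : nat;
  layer_cols : nat;
  layer_cell : 'I_layer_rows -> 'I_layer_cols -> {linear layer_alg -> A};
  layer_f : A -> 'I_layer_rows -> 'I_layer_rows -> layer_alg;
  layer_g : 'I_layer_cols -> A -> 'I_layer_cols -> layer_alg;
  layer_division : division_ring layer_alg;
  layer_span : forall x, x \in K' <->
    exists d, x - \sum_i \sum_j layer_cell i j (d i j) \in K;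
  layer_free : forall d, \sum_i \sum_j layer_cell i j (d i j) \in K ->
    forall i j, d i j = 0;
  layer_mull : forall a i j x,
    a * layer_cell i j x - \sum_i' layer_cell i' j (layer_f a i i' * x) \in K;
  layer_mulr : forall a i j x,
    layer_cell i j x * a - \sum_j' layer_cell i j' (x * layer_g j a j') \in K;
  layer_form : exists j i' y, y != 0 /\ forall i j',
    layer_cell i j 1 * layer_cell i' j' 1 - layer_cell i j' y \in K
}.

Lemma pullback_layer (k : fieldType) (A B : falgType k) (K : {vspace A})
    (U : {vspace B}) (p : {linear A -> B}) (s : {linear B -> A}) :
  (forall a b, p (a * b) = p a * p b) -> cancel s p ->
  (forall a, (p a == 0) = (a \in K)) ->
  cell_layer 0 U -> cell_layer K (linfun p @^-1: U).
Proof.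
move=> pM sK pK [D m n c f g divD sp fr ml mr form].
have KE x : (x \in K) = (p x \in 0%VS) by rewrite memv0 pK.
have pS (d : 'I_m -> 'I_n -> D) :
    p (\sum_i \sum_j (s \o c i j) (d i j)) = \sum_i \sum_j c i j (d i j).
  rewrite linear_sum; apply: eq_bigr => i _; rewrite linear_sum.
  by apply: eq_bigr => j _ /=; rewrite sK.
apply: (@CellLayer _ _ _ _ D m n (fun i j => s \o c i j)
  (fun a => f (p a)) (fun j a => g j (p a)) divD).
- move=> x; rewrite -memv_preim lfunE; split=> [/sp[d dE]|[d dE]].
    by exists d; rewrite KE linearB pS.
  by apply/sp; exists d; rewrite -pS -linearB -KE.
- by move=> d; rewrite KE pS => /fr.
- move=> a i j x; rewrite KE linearB pM /= sK linear_sum.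
  by under eq_bigr do rewrite /= sK; apply: ml.
- move=> a i j x; rewrite KE linearB pM /= sK linear_sum.
  by under eq_bigr do rewrite /= sK; apply: mr.
- have [j [i' [y [y0 yE]]]] := form; exists j, i', y; split=> // i j'.
  by rewrite KE linearB pM /= !sK.
Qed.

Section CornerLayer.
Variables (k : fieldType) (B : falgType k).
Implicit Types (H : {vspace B}).

Lemma division_ring_corner (D : nzRingType) (h : {additive D -> B}) e :
  injective h -> h 1 = e -> (forall x y, h (x * y) = h x * h y) ->
  (forall x, e * x * e = x -> exists d, h d = x) ->
  division_corner e -> division_ring D.
Proof.
move=> hI h1 hM hC divE x x0.
have hx0 : h x != 0 by apply: contra_neq x0 => hx; apply: hI; rewrite hx raddf0.
have xE : e * h x * e = h x by rewrite -h1 -!hM mul1r mulr1.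
have [y [yE yx xy]] := divE _ xE hx0; have [d dE] := hC y yE.
by exists d; split; apply: hI; rewrite hM dE h1.
Qed.

(** The layer is U = B e B for an idempotent e with division corner.  It is defined
    as the span of the cells a_i D b_j, which contains e because e = e e is a
    combination of the a_i times a combination of the b_j. *)
Lemma exists_corner_layer H : two_sided H -> (H <= H * H)%VS -> radical_kills H ->
  dual_basis_mod 0 H -> H != 0%VS ->
  exists U : {vspace B},
    [/\ two_sided U, (U <= U * U)%VS, (U <= H)%VS, U != 0%VS
      & inhabited (cell_layer 0 U)].
Proof.
move=> Hid HH radH dualH H0.
have [e [He ee e0 divE]] := exists_division_corner Hid HH radH H0.
have [D [h [hI h1 hM hC]]] := exists_corner_algebra ee e0.
have divD : division_ring D := division_ring_corner hI h1 hM hC divE.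
have eh d : e * h d = h d by rewrite -h1 -hM mul1r.
have he d : h d * e = h d by rewrite -h1 -hM mulr1.
have [n [b [eb sb fb]]] : exists n (b : 'I_n -> B),
    [/\ forall j, e * b j = b j,
        forall v, exists d, e * v = \sum_j h (d j) * b j
      & forall d, \sum_j h (d j) * b j = 0 -> forall j, d j = 0].
  have [|||||n [b [eb sb fb]]] := @division_basis k D B (fun d v => h d * v) 1.
  - by move=> v c x y; rewrite linearP mulrDl scalerAl.
  - by move=> d c x y; rewrite mulrDr scalerAr.
  - by move=> d d'; exists (d * d') => v; rewrite hM mulrA.
  - by move=> d /divD[d' [dd' _]]; exists d' => v; rewrite mulrA -hM dd'.
  - by move=> v; rewrite mulrA -hM mulr1.
  by exists n, b; rewrite h1 in eb sb.
have [m [a [ae sa fa]]] : exists m (a : 'I_m -> B),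
    [/\ forall i, a i * e = a i,
        forall v, exists d, v * e = \sum_i a i * h (d i)
      & forall d, \sum_i a i * h (d i) = 0 -> forall i, d i = 0].
  have [|||||m [a [ae sa fa]]] := @division_basis k D B (fun d v => v * h d) 1.
  - by move=> v c x y; rewrite linearP mulrDr scalerAr.
  - by move=> d c x y; rewrite mulrDl scalerAl.
  - by move=> d d'; exists (d' * d) => v; rewrite hM mulrA.
  - by move=> d /divD[d' [_ dd']]; exists d' => v; rewrite -mulrA -hM dd'.
  - by move=> v; rewrite -mulrA -hM mulr1.
  by exists m, a; rewrite h1 in ae sa.
have tens (u : 'I_n -> B) : (forall j, u j * e = u j) ->
    \sum_j u j * b j = 0 -> forall j, u j = 0.
  apply: corner_mul_free He ee e0 divE _ _ eb _ _ => // d de db j.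
  have [dd ddE] := choice (fun j => hC _ (de j)).
  by rewrite -ddE (fb dd) ?raddf0 // -[RHS]db; apply: eq_bigr => l _; rewrite ddE.
pose c0 i j d := a i * h d * b j.
have c0_lin i j : linear (c0 i j).
  by move=> l x y; rewrite /c0 linearP mulrDr mulrDl -scalerAr -scalerAl.
pose c i j : {linear D -> B} :=
  HB.pack (c0 i j) (GRing.isLinear.Build k D B *:%R (c0 i j) (c0_lin i j)).
pose S (d : {ffun 'I_m * 'I_n -> D}) := \sum_i \sum_j c i j (d (i, j)).
have S_lin : linear S.
  move=> l x y; rewrite /S scaler_sumr -big_split; apply: eq_bigr => i _ /=.
  rewrite scaler_sumr -big_split; apply: eq_bigr => j _ /=.
  by rewrite !ffunE; apply: c0_lin.
pose Sl : {linear {ffun 'I_m * 'I_n -> D} -> B} :=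
  HB.pack S (GRing.isLinear.Build k _ B *:%R S S_lin).
pose U := limg (linfun Sl).
have UP x : x \in U <-> exists d : 'I_m -> 'I_n -> D, x = \sum_i \sum_j c i j (d i j).
  split=> [/memv_imgP[d _ ->]|[d ->]].
    by exists (fun i j => d (i, j)); rewrite lfunE.
  apply/memv_imgP; exists [ffun p => d p.1 p.2]; rewrite ?memvf // lfunE.
  by apply: eq_bigr => i _; apply: eq_bigr => j _; rewrite ffunE.
have [f fE] : exists f : B -> 'I_m -> 'I_m -> D,
    forall v i, v * a i = \sum_i' a i' * h (f v i i').
  have H1 v : exists f : 'I_m -> 'I_m -> D, forall i, v * a i = \sum_i' a i' * h (f i i').
    have H2 i : exists d, v * a i = \sum_i' a i' * h (d i').
      by have [d dE] := sa (v * a i); exists d; rewrite -dE -mulrA ae.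
    by have [f0 f0E] := choice H2; exists f0.
  by have [f0 f0E] := choice H1; exists f0.
have [g gE] : exists g : 'I_n -> B -> 'I_n -> D,
    forall j v, b j * v = \sum_j' h (g j v j') * b j'.
  have H1 j : exists g : B -> 'I_n -> D, forall v, b j * v = \sum_j' h (g v j') * b j'.
    have H2 v : exists d, b j * v = \sum_j' h (d j') * b j'.
      by have [d dE] := sb (b j * v); exists d; rewrite -dE mulrA eb.
    by have [f0 f0E] := choice H2; exists f0.
  by have [f0 f0E] := choice H1; exists f0.
have mull v i j x : v * c i j x = \sum_i' c i' j (f v i i' * x).
  rewrite /= /c0 !mulrA fE !mulr_suml; apply: eq_bigr => i' _.
  by rewrite hM !mulrA.
have mulr v i j x : c i j x * v = \sum_j' c i j' (x * g j v j').
  rewrite /= /c0 -mulrA gE mulr_sumr; apply: eq_bigr => j' _.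
  by rewrite hM !mulrA.
have Uc i j x : c i j x \in U.
  apply/UP; exists (fun i' j' => if (i' == i) && (j' == j) then x else 0).
  rewrite (bigD1 i) //= (bigD1 j) //= !eqxx /= !big1 ?addr0 //.
    move=> i' /negPf ne; rewrite big1 // => j' _; rewrite ne /=.
    by rewrite /c0 raddf0 mulr0 mul0r.
  by move=> j' /negPf ne; rewrite ne /c0 raddf0 mulr0 mul0r.
have Uid : two_sided U.
  move=> v x /UP[d ->]; split.
    rewrite mulr_sumr rpred_sum // => i _; rewrite mulr_sumr rpred_sum // => j _.
    by rewrite mull rpred_sum.
  rewrite mulr_suml rpred_sum // => i _; rewrite mulr_suml rpred_sum // => j _.
  by rewrite mulr rpred_sum.
have [u uE] := sa e; have [w wE] := sb e.
have eE : e = \sum_i \sum_j a i * h (u i) * h (w j) * b j.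
  transitivity ((\sum_i a i * h (u i)) * (\sum_j h (w j) * b j)).
    by rewrite -uE -wE !ee.
  rewrite mulr_suml; apply: eq_bigr => i _.
  by rewrite mulr_sumr; apply: eq_bigr => j _; rewrite !mulrA.
have Ue : e \in U.
  rewrite eE; apply: rpred_sum => i _; apply: rpred_sum => j _.
  by rewrite -[_ * h _ * h _]mulrA -hM Uc.
have UU : (U <= U * U)%VS.
  apply/subvP => x /UP[d ->]; apply: rpred_sum => i _; apply: rpred_sum => j _.
  rewrite /= /c0; apply: memv_mul.
    by rewrite -he mulrA; case: (Uid (a i * h (d i j)) e Ue).
  by rewrite -eb; case: (Uid (b j) e Ue).
have UH : (U <= H)%VS.
  apply/subvP => x /UP[d ->]; apply: rpred_sum => i _; apply: rpred_sum => j _.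
  rewrite /= /c0 -mulrA.
  have [_ HbM] := Hid (h (d i j) * b j) e He.
  by have [HaM _] := Hid (a i) _ HbM; rewrite mulrA ae in HaM.
have free0 d : \sum_i \sum_j c i j (d i j) = 0 -> forall i j, d i j = 0.
  rewrite exchange_big => dE i j; apply: (fa (fun i => d i j)).
  apply: (tens (fun j => \sum_i a i * h (d i j))).
    by move=> j'; rewrite mulr_suml; apply: eq_bigr => i' _; rewrite -mulrA he.
  by rewrite -[RHS]dE; apply: eq_bigr => j' _; rewrite mulr_suml.
exists U; split=> //; first by apply/eqP => U0; move: Ue; rewrite U0 memv0 (negPf e0).
constructor; apply: (@CellLayer _ _ _ _ D m n c f g divD).
- move=> x; split=> [/UP[d ->]|[d]]; first by exists d; rewrite subrr mem0v.
  by rewrite memv0 subr_eq0 => /eqP xE; apply/UP; exists d.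
- by move=> d; rewrite memv0 => /eqP; apply: free0.
- by move=> v i j x; rewrite mull subrr mem0v.
- by move=> v i j x; rewrite mulr subrr mem0v.
have baC j i : e * (b j * a i) * e = b j * a i by rewrite mulrA eb -mulrA ae.
(* If all the b_j a_i vanished, then so would e = e e. *)
have [j [i' ba0]] : exists j i', b j * a i' != 0.
  apply: contrapT => nba; case/eqP: e0.
  have -> : e = (\sum_j h (w j) * b j) * (\sum_i a i * h (u i)).
    by rewrite -wE -uE !ee.
  rewrite mulr_suml big1 // => j _; rewrite mulr_sumr big1 // => i _.
  have ba : b j * a i = 0 by apply/eqP/negPn/negP => ba; apply: nba; exists j, i.
  by rewrite -mulrA [b j * _]mulrA ba mul0r mulr0.
have [y yE] := hC _ (baC j i'); exists j, i', y; split.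
  by apply: contra_neq ba0 => y0; rewrite -yE y0 raddf0.
move=> i j'; rewrite /= /c0 h1 !ae yE -[a i * b j * _]mulrA [b j * (_ * _)]mulrA.
by rewrite [a i * (_ * _)]mulrA subrr mem0v.
Qed.

End CornerLayer.

(** * From a heredity chain to a chain of layers *)

Lemma exists_vspace_of_pred (k : fieldType) (V : vectType k) (P : V -> Prop) :
  P 0 -> (forall c x y, P x -> P y -> P (c *: x + y)) ->
  exists U : {vspace V}, forall x, x \in U <-> P x.
Proof.
move=> P0 Plin.
have [||U [UP Umax]] := @exists_argmax _
  (fun U : {vspace V} => forall x, x \in U -> P x) (fun U => \dim U) (\dim {:V}).
- by exists 0%VS => x; rewrite memv0 => /eqP->.
- by move=> U _; apply: dimvS (subvf U).
exists U => x; split=> [/UP //|Px].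
have : (\dim (U + <[x]>)%VS <= \dim U)%N.
  apply: Umax => _ /memv_addP[u Uu [_ /vlineP[c ->] ->]].
  by rewrite addrC; apply: Plin => //; apply: UP.
move=> le; have /eqP -> : U == (U + <[x]>)%VS by rewrite eqEdim addvSl.
by apply: (subvP (addvSr _ _)); apply: memv_line.
Qed.

Section LayerChain.
Variables (k : fieldType) (A : falgType k).
Implicit Types (K H : {vspace A}).

(** H / K is a heredity ideal of A / K.  The radical condition refers to the nil left
    ideals of A, which makes it monotone in K. *)
Record heredity_pair K H : Prop := HeredityPair {
  pair_two_sidedl : two_sided K;
  pair_two_sidedr : two_sided H;
  pair_sub : (K <= H)%VS;
  pair_idempotent : (H <= H * H + K)%VS;
  pair_dual_basis : dual_basis_mod K H;
  pair_radical : forall x, nil_left_ideal x ->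
    forall u v, u \in H -> v \in H -> u * x * v \in K
}.

(** In B = A / K the image of H contains a layer U; its preimage K' is the next term
    of the chain.  The maps of the dual basis preserve K' since they are linear and
    U = U U, so that they send U into U times their values. *)
Lemma heredity_pair_step K H : heredity_pair K H -> K != H ->
  exists K', [/\ heredity_pair K' H, (K <= K')%VS, K != K'
    & inhabited (cell_layer K K')].
Proof.
move=> [Kid Hid KH HH [N [F [q [qH FD FM FK Fq]]]] radH] neKH.
have K1 : 1 \notin K.
  apply: contra neKH => K1; rewrite eqEsubv KH; apply/subvP => x _.
  by rewrite -[x]mulr1; case: (Kid x 1 K1).
have [B [p [s [p1 pM sK pK]]]] := exists_quotient_algebra Kid K1.
have pE x y : x - y \in K -> p x = p y.
  by rewrite -pK linearB subr_eq0 => /eqP.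
have pX x n : p (x ^+ n) = p x ^+ n.
  by elim: n => [|n IH]; rewrite ?expr0 // !exprS pM IH.
pose Hb := (linfun p @: H)%VS.
have HbP x : (p x \in Hb) = (x \in H).
  apply/idP/idP => [/memv_imgP[y Hy]|Hx]; last by rewrite -[p x](lfunE p) memv_img.
  rewrite lfunE => /eqP; rewrite -subr_eq0 -linearB pK => Kxy.
  by rewrite -(subrK y x) rpredD // (subvP KH).
have sH b : b \in Hb -> s b \in H by rewrite -{1}[b]sK HbP.
have Hbid : two_sided Hb.
  move=> a x; rewrite -[a]sK -[x]sK -!pM !HbP; exact: Hid.
have HbHb : (Hb <= Hb * Hb)%VS.
  have HHp : (H * H <= linfun p @^-1: (Hb * Hb))%VS.
    by apply/prodvP => x y Hx Hy; rewrite -memv_preim lfunE pM memv_mul ?HbP.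
  apply/subvP => b /sH /(subvP HH) /memv_addP[x HHx [z Kz sE]].
  have := subvP HHp x HHx; rewrite -memv_preim lfunE -[b]sK sE linearD.
  by move: Kz; rewrite -pK => /eqP ->; rewrite addr0.
have radHb : radical_kills Hb.
  move=> x nx u v Hu Hv.
  have [a|f Kf nf] := nil_mod_ideal (x := s x) Kid.
    by have [n xn] := nx (p a); exists n; rewrite -pK pX pM sK xn.
  have := radH _ nf _ _ (sH _ Hu) (sH _ Hv).
  move: Kf; rewrite -!pK !pM linearB !sK p1 => /eqP->.
  by rewrite subr0 mulr1 => /eqP.
have F0 t x y : x - y \in K -> x \in H -> y \in H -> p (F t x) = p (F t y).
  move=> Kxy Hx Hy; rewrite -[x in LHS](subrK y).
  rewrite (pE _ _ (FD t _ _ _ Hy)); last exact: (subvP KH).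
  by rewrite linearD; have := FK t _ Kxy; rewrite -pK => /eqP->; rewrite add0r.
pose G t b := p (F t (s b)).
have GM t a x : x \in Hb -> G t (a * x) = a * G t x.
  move=> Hx; rewrite /G -{2}[a]sK -pM -(pE _ _ (FM t _ _ (sH _ Hx))).
  have [Hax _] := Hid (s a) _ (sH _ Hx); have [Hax' _] := Hbid a _ Hx.
  by apply: F0; rewrite ?sH // -pK linearB pM !sK subrr.
have GD t x y : x \in Hb -> y \in Hb -> G t (x + y) = G t x + G t y.
  move=> Hx Hy; rewrite /G linearD.
  by rewrite (pE _ _ (FD t _ _ (sH _ Hx) (sH _ Hy))) linearD.
have G0 t : G t 0 = 0 by rewrite -{1}(mul0r 0) GM ?mem0v // mul0r.
have dualHb : dual_basis_mod 0 Hb.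
  exists N, G, (fun t => p (q t)); split=> [t|t x y Hx Hy|t a x Hx|t x|x Hx].
  - by rewrite HbP.
  - by rewrite GD // subrr mem0v.
  - by rewrite GM // subrr mem0v.
  - by rewrite memv0 => /eqP->; rewrite G0 mem0v.
  - rewrite memv0 subr_eq0 -{1}[x]sK (pE _ _ (Fq _ (sH _ Hx))) linear_sum.
    by apply/eqP/eq_bigr => t _; rewrite /= pM.
have Hb0 : Hb != 0%VS.
  apply: contra neKH => /eqP Hb0; rewrite eqEsubv KH; apply/subvP => x.
  by rewrite -HbP Hb0 memv0 pK.
have [U [Uid UU UHb U0 [lay]]] := exists_corner_layer Hbid HbHb radHb dualHb Hb0.
have UP x : (x \in (linfun p @^-1: U)%VS) = (p x \in U) by rewrite -memv_preim lfunE.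
exists (linfun p @^-1: U)%VS; split; last 1 first.
- by constructor; apply: (pullback_layer pM sK pK lay).
- have KU : (K <= linfun p @^-1: U)%VS.
    by apply/subvP => x; rewrite UP -pK => /eqP->; rewrite mem0v.
  split=> //.
  + by move=> a x; rewrite !UP !pM; apply: Uid.
  + by apply/subvP => x; rewrite UP => /(subvP UHb); rewrite HbP.
  + by apply: (subv_trans HH); apply: addvS.
  (* The G t are additive on the image of H only, so the inclusion of U in U U is
     exploited through the subspace W of the b with every G t b in U. *)
  + have [||W WP] := @exists_vspace_of_pred k B
      (fun b => b \in Hb /\ forall t, G t b \in U).
    * by split=> [|t]; rewrite ?G0 mem0v.
    * move=> c x y [Hx Ux] [Hy Uy].
      have Hcx : c *: x \in Hb by rewrite memvZ.
      split=> [|t]; first by rewrite rpredD.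
      by rewrite GD // -mulr_algl GM // rpredD ?Uy // mulr_algl memvZ.
    have UW : (U <= W)%VS.
      apply: (subv_trans UU); apply/prodvP => u v Uu Uv; apply/WP.
      have Hv := subvP UHb v Uv; have [Huv _] := Hbid u v Hv; split=> // t.
      by rewrite GM //; case: (Uid (G t v) u Uu).
    exists N, F, q; split=> // [t x y Hx Hy|t a x Hx|t x|x Hx].
    * by apply: (subvP KU); apply: FD.
    * by apply: (subvP KU); apply: FM.
    * rewrite !UP => Ux; have [Hpx /(_ t)] := (WP _).1 (subvP UW _ Ux).
      have Hx : x \in H by rewrite -HbP.
      by rewrite /G (@F0 t (s (p x)) x) ?sH // -pK linearB sK subrr.
    * by apply: (subvP KU); apply: Fq.
  + by move=> x nx u v Hu Hv; apply: (subvP KU); apply: radH.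
- by apply/subvP => x; rewrite UP -pK => /eqP->; rewrite mem0v.
- apply: contra U0 => /eqP KU; rewrite -subv0; apply/subvP => u Uu.
  by rewrite memv0 -[u]sK pK KU UP sK.
Qed.

(** The chain descends from A to K, so that its index can serve as the label: larger
    labels are deeper. *)
Definition has_layer_chain K := exists (N : nat) (C : nat -> {vspace A}),
  [/\ C 0 = fullv, C N = K
    & forall l, (l < N)%N -> inhabited (cell_layer (C l.+1) (C l))].

Lemma layer_chain_cons K K' :
  inhabited (cell_layer K K') -> has_layer_chain K' -> has_layer_chain K.
Proof.
move=> lay [N [C [C0 CN CL]]].
exists N.+1, (fun l => if (l <= N)%N then C l else K).
split=> [||l]; rewrite ?ltnn // ltnS => lN.
rewrite lN; move: lN; rewrite leq_eqVlt => /orP[/eqP->|lN]; last by rewrite lN; apply: CL.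
by rewrite ltnn CN.
Qed.

Lemma heredity_pair_chain K H :
  heredity_pair K H -> has_layer_chain H -> has_layer_chain K.
Proof.
move=> + chH; have [n] := ubnP (\dim H - \dim K).
elim: n K => // n IH K ltn KH; have [-> //|neKH] := eqVneq K H.
have [K' [KH' sKK' neKK' lay]] := heredity_pair_step KH neKH.
apply: layer_chain_cons lay (IH K' _ KH').
have ltd : (\dim K < \dim K')%N.
  rewrite ltn_neqAle (dimvS sKK') andbT; apply: contra neKK' => /eqP dE.
  by rewrite eqEdim sKK' dE leqnn.
have := dimvS (pair_sub KH'); lia.
Qed.

End LayerChain.

Section HeredityIdeal.
Variables (k : fieldType) (A : falgType k).

Lemma exists_vspace_of_ideal (I : left_ideal A) :
  exists U : {vspace A}, forall x, (x \in U) = (x \in I).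
Proof.
have [||U UP] := @exists_vspace_of_pred k A (fun x => x \in I).
- exact: rpred0.
- move=> c x y Ix Iy; rewrite -mulr_algl; apply: rpredD => //.
  exact: left_idealM.
by exists U => x; apply/idP/idP => /UP.
Qed.

Lemma quot_piX (I : ideal A) x n : quot_pi I (x ^+ n) = quot_pi I x ^+ n.
Proof. by elim: n => [|n IH] //; rewrite !exprS quot_piM IH. Qed.

Lemma left_inverse_one_sub_nil (R : pzRingType) (x : R) n :
  x ^+ n = 0 -> exists y, y * (1 - x) = 1.
Proof.
move=> xn; exists (\sum_(i < n) x ^+ i).
have := subrX1 x n; rewrite xn sub0r => /(congr1 -%R); rewrite opprK.
have c : GRing.comm (x - 1) (\sum_(i < n) x ^+ i).
  apply: commr_sum => i _; apply/commr_sym/commrB; last exact: commr1.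
  exact/commr_sym/commrX.
by rewrite c -mulrN opprB => <-.
Qed.

(** If x is outside a maximal left ideal M then 1 = m + b x with m in M, and m = 1 - b x
    is invertible because b x is nilpotent. *)
Lemma jacobson_of_nil (R : pzRingType) (x : R) :
  (forall a, exists n, (a * x) ^+ n = 0) -> jacobson_radical x.
Proof.
move=> nx M [M1 Mmax]; apply: contrapT => Mx.
pose P : {pred R} := fun y => `[< exists m b, m \in M /\ y = m + b * x >].
have PP y : reflect (exists m b, m \in M /\ y = m + b * x) (y \in P) by exact: asboolP.
have Pz : zmod_closed P.
  split; first by apply/PP; exists 0, 0; rewrite mul0r addr0; split=> //; exact: rpred0.
  move=> _ _ /PP[m [b [Mm ->]]] /PP[m' [b' [Mm' ->]]]; apply/PP.
  exists (m - m'), (b - b'); rewrite mulrBl opprD addrACA; split=> //.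
  exact: rpredB.
have PM a y : y \in P -> a * y \in P.
  case/PP=> m [b [Mm ->]]; apply/PP; exists (a * m), (a * b).
  by rewrite mulrDr mulrA; split=> //; apply: left_idealM.
pose L := LeftIdeal Pz PM.
have ML : {subset M <= L}.
  by move=> m Mm; apply/PP; exists m, 0; rewrite mul0r addr0.
have L1 : 1 \in L.
  apply: contrapT => /negP L1; apply/Mx/(Mmax L ML L1).
  by apply/PP; exists 0, 1; rewrite mul1r add0r; split=> //; exact: rpred0.
case/PP: L1 => m [b [Mm e]]; have [n bxn] := nx b.
have [y] := left_inverse_one_sub_nil bxn.
have -> : 1 - b * x = m by rewrite e addrK.
by move=> y1; case/negP: M1; rewrite -y1; apply: left_idealM.
Qed.

Section Pair.
Variables (I I' : ideal A) (sII' : {subset I <= I'}).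
Variables (K H : {vspace A}).
Hypotheses (KI : forall x, (x \in K) = (x \in I)) (HI : forall x, (x \in H) = (x \in I')).

Let piE x y : (quot_pi I x == quot_pi I y) = (x - y \in K).
Proof. by rewrite KI quot_pi_eq. Qed.

Let piP x y : quot_pi I x = quot_pi I y -> x - y \in K.
Proof. by move=> e; rewrite -piE e. Qed.

Let piH x : (quot_pi I x \in quot_ideal sII') = (x \in H).
Proof. by rewrite HI -(quot_ideal_pi sII'). Qed.

(** Lift the identity of H / K through the surjection from a free module given by
    a basis of H. *)
Lemma dual_basis_of_projective :
  projective (left_ideal_mod (quot_ideal sII')) -> dual_basis_mod K H.
Proof.
move=> projH; pose R := ring_quot I; pose P := left_ideal_mod (quot_ideal sII').
pose lft x : P := insubd 0 (quot_pi I x).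
have lftE x : x \in H -> val (lft x) = quot_pi I x.
  by move=> Hx; rewrite insubdK //; move: Hx; rewrite -piH.
pose n := \dim H; pose q (t : 'I_n) := (vbasis H)`_t.
have qH t : q t \in H by apply: vbasis_mem; rewrite mem_nth // size_tuple.
pose g0 (v : 'rV[R]_n) : P := \sum_t v 0 t *: lft (q t).
have g0_lin : linear g0.
  move=> a u v; rewrite /g0 scaler_sumr -big_split; apply: eq_bigr => t _ /=.
  by rewrite !mxE scalerDl scalerA.
pose g : {linear 'rV[R]_n -> P} :=
  HB.pack g0 (GRing.isLinear.Build R _ _ *:%R g0 g0_lin).
have valS (v : 'rV[R]_n) : val (g v) = \sum_t v 0 t * quot_pi I (q t).
  rewrite [g v]/(g0 v) /g0 raddf_sum; apply: eq_bigr => t _.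
  by rewrite -lftE.
have piS m (F G : 'I_m -> A) :
    quot_pi I (\sum_t F t * G t) = \sum_t quot_pi I (F t) * quot_pi I (G t).
  elim/big_rec2: _ => [|t x y _ <-]; first exact: quot_pi0.
  by rewrite quot_piD quot_piM.
have g_onto y : exists v, g v = y.
  have : quot_repr (val y) \in H by rewrite -piH quot_reprK; apply: valP.
  move=> /coord_vbasis yE.
  exists (\row_t quot_pi I (coord (vbasis H) t (quot_repr (val y)))%:A).
  apply: val_inj; rewrite valS -[RHS]quot_reprK [in RHS]yE.
  under eq_bigr do rewrite mxE.
  rewrite -piS; congr (quot_pi I _); apply: eq_bigr => t _.
  by rewrite mulr_algl.
have [h hE] := projH _ _ g idfun g_onto.
exists n, (fun t x => quot_repr (h (lft x) 0 t)), q; split=> //.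
- move=> t x y Hx Hy; apply: piP; rewrite quot_piD !quot_reprK.
  rewrite (_ : lft (x + y) = lft x + lft y) ?linearD ?mxE //.
  by apply: val_inj; rewrite lftE ?rpredD // quot_piD -!lftE.
- move=> t a x Hx; apply: piP; rewrite quot_piM !quot_reprK.
  rewrite (_ : lft (a * x) = quot_pi I a *: lft x) ?linearZ ?mxE //.
  apply: val_inj; rewrite lftE; last first.
    by move: Hx; rewrite !HI => Hx; apply: left_idealM.
  by rewrite quot_piM -(lftE x).
- move=> t x Kx; rewrite -[quot_repr _]subr0; apply: piP; rewrite quot_reprK quot_pi0.
  rewrite (_ : lft x = 0) ?linear0 ?mxE //.
  have /eqP x0 : quot_pi I x == quot_pi I 0 by rewrite piE subr0.
  by apply: val_inj; rewrite /lft x0 quot_pi0 insubdK // rpred0.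
- move=> x Hx; apply: piP; rewrite -lftE // -[lft x in LHS](hE (lft x)) valS piS.
  by apply: eq_bigr => t _; rewrite quot_reprK.
Qed.

Lemma heredity_pair_of_ideal : heredity_ideal (quot_ideal sII') -> heredity_pair K H.
Proof.
move=> [idemH projH radH]; split.
- by move=> a x; rewrite !KI => Ix; split; [exact: left_idealM | exact: Defs.idealMr].
- by move=> a x; rewrite !HI => Ix; split; [exact: left_idealM | exact: Defs.idealMr].
- by apply/subvP => x; rewrite KI HI; apply: sII'.
- apply/subvP => x; rewrite -piH => /idemH[n [u [v [uv xE]]]].
  pose y := \sum_t quot_repr (u t) * quot_repr (v t).
  rewrite -(subrK y x) addrC; apply: memv_add; last first.
    apply: piP; rewrite xE /y; elim/big_rec2: _ => [|t a b _ ->].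
      by rewrite quot_pi0.
    by rewrite quot_piD quot_piM !quot_reprK.
  apply: rpred_sum => t _; have [Hu Hv] := uv t.
  by apply: memv_mul; rewrite -piH quot_reprK.
- exact: dual_basis_of_projective.
- move=> x nx u v Hu Hv.
  have jx : jacobson_radical (quot_pi I x).
    apply: jacobson_of_nil => a; have [n an] := nx (quot_repr a); exists n.
    by rewrite -[a]quot_reprK -[_ * _]quot_piM -quot_piX an quot_pi0.
  have := radH (quot_pi I u) _ (quot_pi I v); rewrite !piH => /(_ _ Hu jx Hv).
  move=> e; rewrite -[_ * v]subr0; apply: piP.
  by rewrite quot_pi0 !quot_piM; apply: e.
Qed.

End Pair.

Lemma quasi_hereditary_chain : quasi_hereditary A -> has_layer_chain (0%VS : {vspace A}).
Proof.
move=> [n [J [sJ [J0 Jn hJ]]]].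
suff chJ m : (m <= n)%N -> forall K : {vspace A},
    (forall x, (x \in K) = (x \in J (n - m)%N)) -> has_layer_chain K.
  apply: (chJ n) => // x; rewrite subnn memv0.
  by apply/eqP/idP => /J0.
elim: m => [_|m IH mn] K KJ.
  exists 0, (fun=> fullv); split=> //.
  by apply/vspaceP => x; rewrite KJ subn0 Jn memvf.
have [H HJ] := exists_vspace_of_ideal (J (n - m)%N).
have eS : (n - m = (n - m.+1).+1)%N by rewrite -subSn // subSS.
have HJ' x : (x \in H) = (x \in J (n - m.+1).+1) by rewrite HJ eS.
apply: (heredity_pair_chain (H := H)); last exact: IH (ltnW mn) _ HJ.
apply: (heredity_pair_of_ideal KJ HJ' (sII' := sJ _)); apply: hJ.
by rewrite -eS leq_subr.
Qed.

End HeredityIdeal.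

(** * From a chain of layers to a cellular system *)

Section FamilySum.
Variables (V : zmodType) (T : Type) (W : T -> V -> Prop).

Lemma family_sum0 P : family_sum W P 0.
Proof. by exists [::]; rewrite big_nil. Qed.

Lemma family_sumD P x y : family_sum W P x -> family_sum W P y -> family_sum W P (x + y).
Proof.
move=> [s [sW ->]] [s' [sW' ->]]; exists (s ++ s'); rewrite big_cat; split=> // v.
by rewrite mem_cat => /orP[/sW|/sW'].
Qed.

Lemma family_sum1 (P : T -> Prop) t x : P t -> W t x -> family_sum W P x.
Proof.
move=> Pt Wx; exists [:: x]; rewrite big_seq1; split=> // v.
by rewrite inE => /eqP->; exists t.
Qed.

Lemma family_sum_sum P (I : finType) (F : I -> V) :
  (forall i, family_sum W P (F i)) -> family_sum W P (\sum_i F i).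
Proof.
by move=> H; apply: big_ind => // [|x y]; [exact: family_sum0 | exact: family_sumD].
Qed.

Lemma family_sumW (P Q : T -> Prop) x :
  (forall t, P t -> Q t) -> family_sum W P x -> family_sum W Q x.
Proof.
move=> PQ [s [sW ->]]; exists s; split=> // v /sW[t [Pt Wt]].
by exists t; split=> //; apply: PQ.
Qed.

End FamilySum.

Definition malg_of_fun (K : finType) (G : zmodType) (f : K -> G) : {malg G[K]} :=
  \sum_k << f k *g k >>.

Lemma mcoeff_malg_of_fun (K : finType) (G : zmodType) (f : K -> G) k :
  (malg_of_fun f)@_k = f k.
Proof.
rewrite /malg_of_fun raddf_sum (bigD1 k) //= mcoeffU eqxx big1 ?addr0 // => i ne.
by rewrite mcoeffU (negPf ne).
Qed.

Lemma big_malg_of_fun (K : finType) (G V : zmodType) (f : K -> G) (h : K -> G -> V) :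
  (forall k, h k 0 = 0) ->
  \sum_(k <- msupp (malg_of_fun f)) h k (malg_of_fun f)@_k = \sum_k h k (f k).
Proof.
move=> h0; rewrite -[RHS]big_enum /=.
under [RHS]eq_bigr do rewrite -mcoeff_malg_of_fun.
apply/esym/big_uniq_sub; rewrite ?enum_uniq ?fset_uniq // => k.
  by rewrite mem_enum.
by move=> /mcoeff_outdom ->.
Qed.

Section LayerSystem.
Variables (k : fieldType) (A : falgType k) (N : nat) (C : nat -> {vspace A}).
Hypotheses (C0 : C 0 = fullv) (CN : C N = 0%VS).
Variable lay : forall l : 'I_N, cell_layer (C l.+1) (C l).

Let I (l : 'I_N) : choiceType := 'I_(layer_rows (lay l)).
Let J (l : 'I_N) : choiceType := 'I_(layer_cols (lay l)).
Let D (l : 'I_N) : algType k := layer_alg (lay l).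
Let c (l : 'I_N) : I l -> J l -> {linear D l -> A} := @layer_cell _ _ _ _ (lay l).

Local Notation T := (cell_index I J).
Let idx l (i : I l) (j : J l) : T := Tagged (fun l => (I l * J l)%type) (i, j).

Let layer_antitone m n : (m <= n <= N)%N -> (C n <= C m)%VS.
Proof.
elim: n => [|n IH]; first by rewrite leqn0 => /andP[/eqP->].
case/andP; rewrite leq_eqVlt => /orP[/eqP-> //|mn nN].
apply: subv_trans (IH _); last by rewrite -ltnS mn ltnW.
apply/subvP => x Cx; apply/(layer_span (lay (Ordinal nN))); exists (fun _ _ => 0).
rewrite big1 ?subr0 // => i _; rewrite big1 // => j _; exact: raddf0.
Qed.

Let layer_mem (t : T) x : cell_image c t x -> x \in C (tag t).
Proof.
case: t => l [i j] [y ->] /=; apply/(layer_span (lay l)).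
exists (fun i' j' => if (i' == i) && (j' == j) then y else 0).
rewrite (bigD1 i) //= (bigD1 j) //= !eqxx /= !big1 ?addr0 ?subrr ?mem0v //.
  move=> i' /negPf ne; rewrite big1 // => j' _; rewrite ne /=; exact: raddf0.
move=> j' /negPf ne; rewrite ne; exact: raddf0.
Qed.

Let layer_family_sum m x : (m <= N)%N -> x \in C m ->
  family_sum (cell_image c) (fun t => (m <= tag t)%N) x.
Proof.
move=> mN; have [n nE] : exists n, (m + n = N)%N by exists (N - m)%N; rewrite subnKC.
elim: n m {mN} nE x => [|n IH] m nE x.
  by move: nE; rewrite addn0 => ->; rewrite CN memv0 => /eqP->; apply: family_sum0.
have mN : (m < N)%N by rewrite -nE addnS ltnS leq_addr.
case/(layer_span (lay (Ordinal mN))) => d Cd.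
rewrite -(subrK (\sum_i \sum_j layer_cell i j (d i j)) x).
apply: family_sumD.
  by apply: family_sumW (IH _ _ _ Cd); [move=> t; apply: ltnW | rewrite addSn -addnS].
apply: family_sum_sum => i; apply: family_sum_sum => j.
by apply: (@family_sum1 _ _ _ _ (@idx (Ordinal mN) i j)) => //; exists (d i j).
Qed.

(* Independence is proved label by label: once the components of the labels below m
   vanish, the relation shows that the component of label m lies in C m.+1, and
   layer_free applies. *)
Let cell_direct_layers : internal_direct_sum (cell_image c).
Proof.
split=> [x|s v us sv sv0].
  by apply: family_sumW (layer_family_sum (leq0n N) _) => //; rewrite C0 memvf.
have [x xE] : exists x : forall t : T, D (tag t), forall t, t \in s ->
    v t = c (tagged t).1 (tagged t).2 (x t).
  have H t : exists y : D (tag t), t \in s -> v t = c (tagged t).1 (tagged t).2 y.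
    have [ts|ts] := boolP (t \in s); last by exists 0.
    by have [y yE] := sv t ts; exists y.
  by exists (fun t => projT1 (cid (H t))) => t ts; apply: (projT2 (cid (H t))).
suff H m : (m <= N)%N -> forall t, t \in s -> (tag t < m)%N -> v t = 0.
  by move=> t ts; apply: (H N) => //; apply: ltn_ord.
elim: m => [//|m IH mN t ts]; rewrite ltnS leq_eqVlt => /orP[/eqP tm|]; last first.
  exact: IH (ltnW mN) t ts.
pose l := Ordinal mN.
pose F (u : T) := if (tag u == l) && (u \in s) then v u else 0.
pose s1 := [seq u <- s | tag u == l].
pose s2 := [seq @idx l i j | i <- enum 'I_(layer_rows (lay l)),
                             j <- enum 'I_(layer_cols (lay l))].
pose d i j := if @idx l i j \in s then x (@idx l i j) else 0.
have us2 : uniq s2.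
  apply: allpairs_uniq; rewrite ?enum_uniq // => -[i j] [i' j'] _ _ /eqP.
  by rewrite /idx eq_Tagged /= => /eqP.
have s12 : {subset s1 <= s2}.
  case=> l' [i j]; rewrite mem_filter => /andP[/eqP /= ll' _].
  by subst l'; apply/allpairsP; exists (i, j); rewrite !mem_enum.
have FE : \sum_(u <- s1) F u = \sum_i \sum_j layer_cell i j (d i j).
  rewrite -(big_uniq_sub (filter_uniq _ us) us2 s12) => [|u]; last first.
    by rewrite mem_filter /F => /negPf->.
  rewrite /s2 big_allpairs_dep big_enum; apply: eq_bigr => i _.
  rewrite big_enum; apply: eq_bigr => j _; rewrite /F /d eqxx /=.
  by case: ifP => [/xE|_]; last by rewrite raddf0.
have CF : \sum_(u <- s1) F u \in C l.+1.
  have -> : \sum_(u <- s1) F u = - \sum_(u <- s | tag u != l) v u.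
    apply/eqP; rewrite -addr_eq0 -[X in _ == X]sv0.
    rewrite [X in _ == X](bigID (fun u => tag u == l)) /=.
    rewrite -[X in _ == X + _]big_filter; apply/eqP; congr (_ + _).
    by apply: eq_big_seq => u; rewrite mem_filter /F => ->.
  rewrite rpredN big_seq_cond rpred_sum // => u /andP[us' ul].
  have [um|mu] := ltnP (tag u) m; first by rewrite (IH (ltnW mN) u us' um) mem0v.
  apply: (subvP (@layer_antitone _ (tag u) _)); last exact: layer_mem (sv u us').
  rewrite (ltnW (ltn_ord (tag u))) andbT ltn_neqAle mu andbT eq_sym.
  by apply: contra ul => /eqP um; apply/eqP/val_inj.
move: CF; rewrite FE => /layer_free d0.
case: t tm ts => l' [i j] /= tm ts.
have ll' : l' = l by apply: val_inj.
subst l'; rewrite xE //= (_ : x _ = 0) ?raddf0 //.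
by have := d0 i j; rewrite /d ts.
Qed.

Hypotheses (I0 : forall l, inhabited (I l)) (J0 : forall l, inhabited (J l)).

Let cell_inj_layers l (i : I l) (j : J l) : injective (@c l i j).
Proof.
apply: raddf_inj => x cx0.
have := @layer_free _ _ _ _ (lay l) (fun i' j' => if (i' == i) && (j' == j) then x else 0).
rewrite (bigD1 i) //= (bigD1 j) //= !eqxx /= !big1 ?addr0.
- by rewrite [layer_cell _ _ _]cx0 => /(_ (mem0v _) i j); rewrite !eqxx.
- move=> i' /negPf ne; rewrite big1 // => j' _; rewrite ne /=; exact: raddf0.
- move=> j' /negPf ne; rewrite ne; exact: raddf0.
Qed.

Let cell_gt_layers (l : 'I_N) x : x \in C l.+1 -> cell_gt c l x.
Proof. by move/layer_family_sum; apply; apply: ltn_ord. Qed.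

Let cell_mull_layers a l (i : I l) (j : J l) (x : D l) :
  let f := malg_of_fun (layer_f (c := lay l) a i) in
  cell_gt c l (a * c i j x - \sum_(i' <- msupp f) c i' j (f@_i' * x)).
Proof.
move=> f; apply: cell_gt_layers.
rewrite (big_malg_of_fun _ (h := fun i' y => c i' j (y * x))); first exact: layer_mull.
by move=> i'; rewrite mul0r raddf0.
Qed.

Let cell_mulr_layers a l (i : I l) (j : J l) (x : D l) :
  let g := malg_of_fun (layer_g (c := lay l) j a) in
  cell_gt c l (c i j x * a - \sum_(j' <- msupp g) c i j' (x * g@_j')).
Proof.
move=> g; apply: cell_gt_layers.
rewrite (big_malg_of_fun _ (h := fun j' y => c i j' (x * y))); first exact: layer_mulr.
by move=> j'; rewrite mulr0 raddf0.
Qed.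

Definition layer_system : cellular_system A I J D :=
  CellularSystem I0 J0 cell_inj_layers cell_direct_layers
    cell_mull_layers cell_mulr_layers.

Lemma layer_system_irr l : Lambda_irr layer_system l.
Proof.
have [j [i' [y [y0 yE]]]] := layer_form (lay l).
exists (tens (@Deltaop_b _ _ _ _ _ _ _ layer_system l j 1)
             (@Delta_a _ _ _ _ _ _ _ layer_system l i' 1)).
rewrite phi_tens mul1r mulr1; have [[i] [j']] := (I0 l, J0 l).
rewrite (_ : cell_fJI _ _ _ = y); first exact/eqP.
apply: (@cell_fJI_uniq _ _ _ _ _ _ _ layer_system l j i' _ y i j').
  by have := @cell_fJIP _ _ _ _ _ _ _ layer_system l j i' i j' 1 1; rewrite mul1r mulr1.
by apply: cell_gt_layers; apply: yE.
Qed.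

End LayerSystem.

Lemma layer_chain_system (k : fieldType) (A : falgType k) :
  has_layer_chain (0%VS : {vspace A}) -> has_irr_divisible_system A.
Proof.
move=> [N [C [C0 CN CL]]].
have [lay] : inhabited (forall l : 'I_N, cell_layer (C l.+1) (C l)).
  constructor=> l; have ex : exists _ : cell_layer (C l.+1) (C l), True.
    by have [x] := CL l (ltn_ord l); exists x.
  exact: (projT1 (cid ex)).
have I0 l : inhabited 'I_(layer_rows (lay l)).
  by have [_ [i _]] := layer_form (lay l).
have J0 l : inhabited 'I_(layer_cols (lay l)).
  by have [j _] := layer_form (lay l).
exists _, 'I_N, _, _, _, (layer_system C0 CN I0 J0); split.
  by move=> l; apply: layer_division.
exact: layer_system_irr.
Qed.

(** * Idempotents and the radical of a quotient *)

Lemma exists_full_seq (T : eqType) (N : nat) :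
  (forall s : seq T, uniq s -> (size s <= N)%N) ->
  exists2 s : seq T, uniq s & forall t, t \in s.
Proof.
move=> bd; have [||s [us smax]] := @exists_argmax (seq T) uniq size N.
- by exists [::].
- exact: bd.
exists s => // t; apply: contraT => ts.
by have := smax (t :: s); rewrite /= ts us ltnn => /(_ isT).
Qed.

Section MaximalIdeal.
Variables (k : fieldType) (A : falgType k) (I : ideal A).
Local Notation R := (ring_quot I).

(** A left ideal of the quotient whose preimage in A has the largest possible
    dimension is maximal. *)
Lemma exists_maximal_left_ideal (z : R) :
  (forall b, b * z <> 1) -> exists M : left_ideal R, maximal_left_ideal M /\ z \in M.
Proof.
move=> zN.
have ex (M : left_ideal R) :
    exists U : {vspace A}, forall x, x \in U <-> quot_pi I x \in M.
  apply: exists_vspace_of_pred => [|c x y Mx My]; first by rewrite quot_pi0 [_ \in _]rpred0.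
  by rewrite -mulr_algl quot_piD quot_piM; apply: rpredD => //; apply: left_idealM.
pose pre M := projT1 (cid (ex M)).
have preE M x : x \in pre M <-> quot_pi I x \in M := projT2 (cid (ex M)) x.
have [||M [[Mz M1] Mmax]] := @exists_argmax (left_ideal R)
  (fun M => z \in M /\ 1 \notin M) (fun M => \dim (pre M)) (\dim {:A}).
- pose P : {pred R} := fun y => `[< exists b, y = b * z >].
  have PP y : reflect (exists b, y = b * z) (y \in P) by exact: asboolP.
  have Pz : zmod_closed P.
    split; first by apply/PP; exists 0; rewrite mul0r.
    by move=> _ _ /PP[b ->] /PP[b' ->]; apply/PP; exists (b - b'); rewrite mulrBl.
  have PM a y : y \in P -> a * y \in P.
    by case/PP=> b ->; apply/PP; exists (a * b); rewrite mulrA.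
  exists (LeftIdeal Pz PM); split; first by apply/PP; exists 1; rewrite mul1r.
  by apply/negP => /PP[b /esym]; apply: zN.
- by move=> M _; apply: dimvS (subvf _).
exists M; split=> //; split=> // M' MM' M'1 y M'y.
have sub : (pre M <= pre M')%VS by apply/subvP => x /preE Mx; apply/preE/MM'.
have /eqP E : pre M == pre M'.
  by rewrite eqEdim sub; apply: Mmax; split=> //; apply: MM'.
by rewrite -[y]quot_reprK; apply/preE; rewrite E; apply/preE; rewrite quot_reprK.
Qed.

Lemma jacobson_radicalMl (a x : R) : jacobson_radical x -> jacobson_radical (a * x).
Proof. by move=> jx M /jx Mx; apply: left_idealM. Qed.

(** Otherwise 1 - p would generate a proper left ideal, and a maximal one containing
    it would also contain p. *)
Lemma jacobson_idempotent0 (p : R) : jacobson_radical p -> p * p = p -> p = 0.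
Proof.
move=> jp pp; apply: contrapT => p0.
have [b b1|M [mM M1p]] := @exists_maximal_left_ideal (1 - p).
  by apply: p0; rewrite -[p]mul1r -b1 -mulrA mulrBl mul1r pp subrr mulr0.
by have [/negP[]] := mM; rewrite -(subrK p 1); apply: rpredD => //; apply: jp.
Qed.

(** If e = x y is idempotent then so is y e x, which lies in the radical with x. *)
Lemma jacobson_idempotent_factor (e x y : R) :
  jacobson_radical x -> x * y = e -> e * e = e -> e = 0.
Proof.
move=> jx xy ee.
have p0 : y * e * x = 0.
  apply: jacobson_idempotent0; first exact: jacobson_radicalMl.
  by rewrite !mulrA -[_ * x * y]mulrA xy -[y * e * e]mulrA ee -[y * e * e]mulrA ee.
by rewrite -ee -{1}ee -{1 3}xy -[x * y * e]mulrA -mulrA [y * e * _]mulrA p0 mul0r mulr0.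
Qed.

End MaximalIdeal.

(** * From a cellular system to a heredity chain *)

Section CellIdeals.
Variables (k : fieldType) (A : falgType k).
Variables (d : Order.disp_t) (L : porderType d).
Variables (I J : L -> choiceType) (D : L -> algType k).
Variable c : cellular_system A I J D.

Local Notation T := (cell_index I J).
Let cc (t : T) : {linear D (tag t) -> A} := cell c (tagged t).1 (tagged t).2.
Let coord (t : T) (a : A) : D (tag t) := cell_coord c (tagged t).1 (tagged t).2 a.
Let idx l (i : I l) (j : J l) : T := Tagged (fun l => (I l * J l)%type) (i, j).

(** The elements c_t(1) are linearly independent, as the sum of the cells is direct. *)
Lemma cell_index_bounded (s : seq T) : uniq s -> (size s <= \dim {:A})%N.
Proof.
case: s => // t0 s0; set s := t0 :: s0 => us.
have cc1 t : cc t 1 != 0.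
  apply/eqP => e; have := @cell_inj _ _ _ _ _ _ _ c _ (tagged t).1 (tagged t).2 1 0.
  by rewrite [cell _ _ _ _]e raddf0 => /(_ erefl)/eqP; rewrite oner_eq0.
pose X := [seq cc t 1 | t <- s].
have fX : free (in_tuple X).
  apply/freeP => a a0 i.
  have sX : size X = size s by rewrite size_map.
  pose a' t := oapp a 0 (insub (index t s)).
  have a'E (j : 'I_(size X)) : a' (nth t0 s j) = a j.
    by rewrite /a' index_uniq -?sX // valK.
  have := (cell_direct c).2 s (fun t => cc t (a' t)%:A) us _ _ (nth t0 s i) _.
  rewrite mem_nth -?sX // => H.
  have {}H : cc (nth t0 s i) (a' (nth t0 s i))%:A = 0.
    apply: H => //; first by move=> t _; exists (a' t)%:A.
    rewrite -[RHS]a0 (big_nth t0) -sX big_mkord; apply: eq_bigr => j _.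
    rewrite linearZ /= a'E (nth_map t0) //.
    by rewrite -sX.
  move: H; rewrite linearZ /= a'E => /eqP.
  by rewrite scaler_eq0 (negPf (cc1 _)) orbF => /eqP.
have -> : size s = size X by rewrite size_map.
by move: fX; rewrite /free => /eqP <-; apply: dimvS (subvf _).
Qed.

Lemma is_coord_cell_coord a : is_coord c a (coord^~ a).
Proof.
have [x ax] := is_coord_ex c a; have [s [us xs aE]] := ax.
have cE t : coord t a = x t by case: t => l [i j]; apply: cell_coordE.
exists s; split=> // [t /xs|]; first by rewrite -cE.
by rewrite {1}aE; apply: eq_bigr => t _; rewrite -cE.
Qed.

Lemma cell_coord_neq_tag (t u : T) x : t != u -> coord u (cc t x) = 0.
Proof. by move=> tu; apply: cell_coord_neq; case: u tu => l [i j]. Qed.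

Section SpanIdeal.
Variable P : pred L.
Hypothesis upP : forall l m, P l -> (l < m)%O -> P m.

(** The sum of the cells with label in P, described by the vanishing of the other
    coordinates. *)
Definition cell_span : {pred A} :=
  fun a => `[< forall t : T, ~~ P (tag t) -> coord t a = 0 >].

Lemma cell_spanP a :
  reflect (forall l (i : I l) (j : J l), ~~ P l -> cell_coord c i j a = 0)
    (a \in cell_span).
Proof.
apply: (iffP (asboolP _)) => [H l i j|H [l [i j]]]; last exact: H.
exact: (H (idx i j)).
Qed.

Fact cell_span_zmod : zmod_closed cell_span.
Proof.
split=> [|x y /cell_spanP Hx /cell_spanP Hy]; apply/cell_spanP => l i j Pl.
  exact: raddf0.
by rewrite raddfB /= Hx // Hy // subrr.
Qed.

HB.instance Definition _ := GRing.isZmodClosed.Build A cell_span cell_span_zmod.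

Lemma cell_mem_span l (i : I l) (j : J l) x : P l -> cell c i j x \in cell_span.
Proof.
move=> Pl; apply/asboolP => t nPt; apply: (@cell_coord_neq_tag (idx i j)).
by apply: contraNneq nPt => <-.
Qed.

Lemma cell_gt_span l a : (forall m, (l < m)%O -> P m) -> cell_gt (cell c) l a ->
  a \in cell_span.
Proof.
move=> lP [s [sc ->]]; rewrite big_seq rpred_sum // => v /sc[[m [i j]] [lm [x ->]]].
exact/cell_mem_span/lP.
Qed.

Fact cell_spanMl b a : a \in cell_span -> b * a \in cell_span.
Proof.
move=> /cell_spanP Ha; have [s [_ _ ->]] := is_coord_cell_coord a.
rewrite mulr_sumr rpred_sum // => -[l [i j]] _ /=.
have [Pl|/Ha a0] := boolP (P l); last by rewrite /coord a0 raddf0 mulr0 rpred0.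
rewrite -(subrK (\sum_(i' <- msupp (cell_f c b i))
   cell c i' j ((cell_f c b i)@_i' * coord (idx i j) a)) (b * _)) rpredD //.
  by apply: cell_gt_span (cell_mull _ _ _ _ _) => m; apply: upP.
by rewrite rpred_sum // => i' _; apply: cell_mem_span.
Qed.

Fact cell_spanMr b a : a \in cell_span -> a * b \in cell_span.
Proof.
move=> /cell_spanP Ha; have [s [_ _ ->]] := is_coord_cell_coord a.
rewrite mulr_suml rpred_sum // => -[l [i j]] _ /=.
have [Pl|/Ha a0] := boolP (P l); last by rewrite /coord a0 raddf0 mul0r rpred0.
rewrite -(subrK (\sum_(j' <- msupp (cell_g c j b))
   cell c i j' (coord (idx i j) a * (cell_g c j b)@_j')) (_ * b)) rpredD //.
  by apply: cell_gt_span (cell_mulr _ _ _ _ _) => m; apply: upP.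
by rewrite rpred_sum // => j' _; apply: cell_mem_span.
Qed.

Definition cell_ideal : ideal A :=
  @Ideal _ (LeftIdeal cell_span_zmod cell_spanMl) cell_spanMr.

End SpanIdeal.
End CellIdeals.

(** A nonzero value of phi is a sum of terms v_j f(j, i) u_i. *)
Lemma Lambda_irr_form (k : fieldType) (A : algType k) (d : Order.disp_t) (L : porderType d)
    (I J : L -> choiceType) (D : L -> algType k) (c : cellular_system A I J D) (l : L) :
  Lambda_irr c l -> exists j i, @cell_fJI _ _ _ _ _ _ _ c l j i != 0.
Proof.
case=> t nz; apply: contrapT => form0; apply: nz.
rewrite /phi /tensor_lift /msum big1 // => -[v u] _ /=.
rewrite /phi_form big1 ?mul0rz // => j _; rewrite big1 // => i _.
have [->|fJI] := eqVneq (cell_fJI c j i) 0; first by rewrite mulr0 mul0r.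
by case: form0; exists j, i.
Qed.

Section CellHeredity.
Variables (k : fieldType) (A : falgType k).
Variables (d : Order.disp_t) (L : porderType d).
Variables (I J : L -> choiceType) (D : L -> algType k).
Variable c : cellular_system A I J D.
Variables (P P' : pred L) (l : L).
Hypotheses (upP : forall m m', P m -> (m < m')%O -> P m')
  (upP' : forall m m', P' m -> (m < m')%O -> P' m')
  (Pl : ~~ P l) (P'E : forall m, P' m = P m || (m == l))
  (divD : division_ring (D l)) (irr : Lambda_irr c l).

Local Notation K := (cell_ideal c upP).
Local Notation H := (cell_ideal c upP').
Local Notation R := (ring_quot K).
Local Notation "[ a ]" := (quot_pi K a).

Hypothesis sKH : {subset K <= H}.

Let P'l : P' l. Proof. by rewrite P'E eqxx orbT. Qed.

Let gtP m : (l < m)%O -> P m.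
Proof.
by move=> lm; have := upP' P'l lm; rewrite P'E => /orP[//|/eqP e]; rewrite e ltxx in lm.
Qed.

Let piP a b : cell_gt (cell c) l (a - b) -> [a] = [b].
Proof. by move=> gt; apply/eqP; rewrite quot_pi_eq; apply: cell_gt_span gt; apply: gtP. Qed.

Let piS (S : Type) (s : seq S) (F : S -> A) : [\sum_(t <- s) F t] = \sum_(t <- s) [F t].
Proof.
by elim: s => [|t s IH]; rewrite ?big_nil ?quot_pi0 // !big_cons quot_piD IH.
Qed.

Let pi_mul (i i' : I l) (j j' : J l) (x y : D l) :
  [cell c i j x * cell c i' j' y] = [cell c i j' (x * cell_fJI c j i' * y)].
Proof. exact/piP/cell_fJIP. Qed.

Let exists_invertible_form : exists (i0 : I l) (j0 : J l) (z : D l),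
  z * cell_fJI c j0 i0 = 1 /\ cell_fJI c j0 i0 * z = 1.
Proof.
have [j [i ji]] := Lambda_irr_form irr; have [z [z1 z2]] := divD ji.
by exists i, j, z.
Qed.

Let mem_cell (i : I l) (j : J l) x : [cell c i j x] \in quot_ideal sKH.
Proof. by rewrite (quot_ideal_pi sKH); apply: (@cell_mem_span k A d L I J D c P'). Qed.

Let exists_rows : exists2 s : seq (I l), uniq s & forall i, i \in s.
Proof.
have [j] := cell_J0 c l; apply: (@exists_full_seq _ (\dim {:A})) => s us.
rewrite -(size_map (fun i => Tagged (fun l => (I l * J l)%type) (i, j))).
apply: (cell_index_bounded c); rewrite map_inj_uniq // => i i' /eqP.
by rewrite eq_Tagged /= => /eqP[].
Qed.

Let exists_cols : exists2 s : seq (J l), uniq s & forall j, j \in s.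
Proof.
have [i] := cell_I0 c l; apply: (@exists_full_seq _ (\dim {:A})) => s us.
rewrite -(size_map (fun j => Tagged (fun l => (I l * J l)%type) (i, j))).
apply: (cell_index_bounded c); rewrite map_inj_uniq // => j j' /eqP.
by rewrite eq_Tagged /= => /eqP[].
Qed.

Section Enumerated.
Variables (rows : seq (I l)) (cols : seq (J l)).
Hypotheses (urows : uniq rows) (rowsP : forall i, i \in rows)
  (ucols : uniq cols) (colsP : forall j, j \in cols).

(* The column j of the part of a in the cells of label l, as an element of the
   standard module. *)
Let col (j : J l) (a : A) : {malg (D l)[I l]} :=
  \sum_(i <- rows) << cell_coord c i j a *g i >>.

Local Notation emb j := (msum (fun i => cell c i j)).

Let mcoeff_col j a i : mcoeff i (col j a) = cell_coord c i j a.
Proof.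
rewrite /col raddf_sum (bigD1_seq i) //= mcoeffU eqxx big1 ?addr0 // => i' ne.
by rewrite mcoeffU (negPf ne).
Qed.

Let emb_coord_neq i j j' (u : {malg (D l)[I l]}) :
  j' != j -> cell_coord c i j (emb j' u) = 0.
Proof.
move=> /negPf ne; rewrite raddf_sum big1 // => i' _ /=.
by rewrite cell_coord_cell ne andbF.
Qed.

Let coord_K (i : I l) (j : J l) a b : [a] = [b] -> cell_coord c i j a = cell_coord c i j b.
Proof.
move/eqP; rewrite quot_pi_eq => /cell_spanP/(_ l i j Pl)/eqP.
by rewrite raddfB subr_eq0 => /eqP.
Qed.

Let pi_decomp a : a \in H -> [a] = \sum_(j <- cols) [emb j (col j a)].
Proof.
move=> /cell_spanP Ha; rewrite -piS; apply/eqP; rewrite quot_pi_eq.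
apply/cell_spanP => m i j Pm; rewrite raddfB /= raddf_sum.
have [e|ne] := eqVneq m l.
  subst m; rewrite (bigD1_seq j) //= emb_coord mcoeff_col big1 ?addr0 ?subrr // => j' ne.
  exact: emb_coord_neq.
rewrite Ha ?P'E ?negb_or ?Pm //= sub0r big1 ?oppr0 // => j' _.
rewrite raddf_sum big1 // => i' _ /=.
apply: (@cell_coord_neq _ _ _ _ _ _ _ c (Tagged (fun l => (I l * J l)%type) (i', j'))).
by apply: contraNneq ne => /(congr1 tag) /= ->.
Qed.

Let pi_emb b j (u : {malg (D l)[I l]}) :
  [b * emb j u] = [emb j (Delta_scale b (u : Delta c l))].
Proof. exact/piP/emb_scale. Qed.

Let col_mul b j a : a \in H -> col j (b * a) = Delta_scale b (col j a : Delta c l).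
Proof.
move=> Ha; apply/malgP => i; rewrite [LHS]mcoeff_col.
rewrite (@coord_K _ _ _ (\sum_(j' <- cols) emb j' (Delta_scale b (col j' a : Delta c l)))).
  rewrite raddf_sum (bigD1_seq j) //= emb_coord big1 ?addr0 // => j' ne.
  exact: emb_coord_neq.
rewrite piS quot_piM (pi_decomp Ha).
rewrite [LHS](mulr_sumr _ _ _ ([b] : R)).
by apply: eq_bigr => j' _; rewrite -[LHS]quot_piM pi_emb.
Qed.

Variables (i0 : I l) (j0 : J l) (z : D l).
Hypotheses (zf : z * cell_fJI c j0 i0 = 1) (fz : cell_fJI c j0 i0 * z = 1).

(* Move the column j to the position j0; this is left linear on the ideal because
   the coefficients f of the left action do not depend on the column. *)
Let shift (j : J l) (x : R) : R := [emb j0 (col j (quot_repr x))].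

Let col0 j a b : [a] = [b] -> col j a = col j b.
Proof.
move=> e; apply/malgP => i; rewrite [LHS]mcoeff_col [RHS]mcoeff_col.
exact: coord_K.
Qed.

Let shift_pi j a : shift j [a] = [emb j0 (col j a)].
Proof. by rewrite /shift (col0 _ (quot_reprK [a])). Qed.

Let shiftD j x y : shift j (x + y) = shift j x + shift j y.
Proof.
rewrite -[x]quot_reprK -[y]quot_reprK -quot_piD !shift_pi -quot_piD -raddfD.
congr ([emb j0 _]); apply/malgP => i.
rewrite mcoeffD [LHS]mcoeff_col [X in _ = X + _]mcoeff_col.
by rewrite [X in _ = _ + X]mcoeff_col raddfD.
Qed.

Let memH x : x \in quot_ideal sKH -> quot_repr x \in H.
Proof. by rewrite -{1}[x]quot_reprK (quot_ideal_pi sKH). Qed.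

Let shiftM j b x : x \in quot_ideal sKH -> shift j (b * x) = b * shift j x.
Proof.
move=> Hx; rewrite -[b]quot_reprK -[x in LHS]quot_reprK -[LHS]/(shift j (quot_mul _ _)).
by rewrite -quot_piM shift_pi col_mul ?memH // -pi_emb quot_piM.
Qed.

Let shift_mem j x : shift j x \in quot_ideal sKH.
Proof.
rewrite /shift /msum piS; apply: rpred_sum => i _; exact: mem_cell.
Qed.

Let w j := [cell c i0 j z].

Let shift_w x : x \in quot_ideal sKH -> x = \sum_(j <- cols) shift j x * w j.
Proof.
move=> Hx; rewrite -{1}[x]quot_reprK pi_decomp ?memH //; apply: eq_bigr => j _.
rewrite /shift /w -[RHS]quot_piM /msum mulr_suml !piS; apply: eq_bigr => i _.
by rewrite pi_mul -mulrA fz mulr1.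
Qed.

(* Since x = sum_j shift j x * w j, a homomorphism f is determined by its values at the
   w j; lifting these values lifts f. *)
Let layer_projective : projective (left_ideal_mod (quot_ideal sKH)).
Proof.
move=> M N g f g_onto.
pose W j : left_ideal_mod (quot_ideal sKH) := LeftIdealMod (mem_cell i0 j z).
have [m mE] := choice (fun j => g_onto (f (W j))).
pose h0 (x : left_ideal_mod (quot_ideal sKH)) : M :=
  \sum_(j <- cols) shift j (val x) *: m j.
have h0_lin : linear h0.
  move=> a x y; rewrite /h0 scaler_sumr -big_split; apply: eq_bigr => j _ /=.
  by rewrite shiftD shiftM ?scalerDl ?scalerA //; apply: valP.
pose h : {linear left_ideal_mod (quot_ideal sKH) -> M} :=
  HB.pack h0 (GRing.isLinear.Build R _ M *:%R h0 h0_lin).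
exists h => x; rewrite [h x]/(h0 x) /h0 linear_sum.
under eq_bigr do rewrite linearZ /= mE -linearZ.
rewrite -linear_sum; congr (f _); apply: val_inj.
rewrite raddf_sum [RHS]shift_w; last exact: valP.
by apply: eq_bigr.
Qed.

(* The coefficient y is the value of phi at b_j and r a_i', hence its independence
   of i and j'. *)
Let middle (i' : I l) (j : J l) (r : A) : exists y : D l, forall i j' x x',
  [cell c i j x * r * cell c i' j' x'] = [cell c i j' (x * y * x')].
Proof.
pose f := cell_f c r i'.
exists (\sum_(i1 <- msupp f) cell_fJI c j i1 * f@_i1) => i j' x x'.
have e : [r * cell c i' j' x'] = [\sum_(i1 <- msupp f) cell c i1 j' (f@_i1 * x')].
  by apply: piP; apply: cell_mull.
rewrite -mulrA quot_piM e -quot_piM mulr_sumr mulr_sumr mulr_suml raddf_sum !piS.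
by apply: eq_bigr => i1 _; rewrite pi_mul !mulrA.
Qed.

Let middle0 (i i' : I l) (j j' : J l) (x x' : D l) (r : A) : jacobson_radical [r] ->
  [cell c i j x * r * cell c i' j' x'] = 0.
Proof.
move=> jr; have [y yE] := middle i' j r; rewrite yE.
have [->|/divD[v [vy yv]]] := eqVneq y 0; first by rewrite mulr0 mul0r raddf0 quot_pi0.
pose e := [cell c i0 j0 z].
have ee : e * e = e by rewrite -[LHS]quot_piM pi_mul zf mul1r.
have : e = 0.
  apply: (@jacobson_idempotent_factor _ _ K e
    [cell c i0 j 1 * r] [cell c i' j0 (v * z)]) => //.
    by rewrite quot_piM; apply: jacobson_radicalMl.
  by rewrite -[LHS]quot_piM yE mul1r mulrA yv mul1r.
rewrite -[0]quot_pi0 => /(coord_K i0 j0); rewrite cell_coord_id raddf0 => z0.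
by move: zf; rewrite z0 mul0r => /eqP; rewrite eq_sym oner_eq0.
Qed.

Lemma enumerated_heredity : heredity_ideal (quot_ideal sKH).
Proof.
split; last 1 first.
- move=> x r y Hx jr Hy.
  rewrite -[x]quot_reprK -[y]quot_reprK -[r]quot_reprK in jr *.
  rewrite (pi_decomp (memH Hx)) (pi_decomp (memH Hy)) mulr_suml mulr_suml big1 // => j _.
  rewrite mulr_sumr big1 // => j' _; rewrite /msum !piS mulr_suml mulr_suml big1 // => i _.
  rewrite mulr_sumr big1 // => i' _.
  have := middle0 i i' j j' ((col j (quot_repr x))@_i) ((col j' (quot_repr y))@_i') jr.
  by rewrite !quot_piM.
- move=> x; split=> [Hx|[n [u [v [uv ->]]]]].
    exists (size cols), (fun t => shift (tnth (in_tuple cols) t) x),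
      (fun t => w (tnth (in_tuple cols) t)); split.
      by move=> t; split; [exact: shift_mem | exact: mem_cell].
    by rewrite {1}[x]shift_w // big_tnth.
  by apply: rpred_sum => t _; apply: left_idealM; case: (uv t).
- exact: layer_projective.
Qed.

End Enumerated.
Lemma cell_ideal_heredity : heredity_ideal (quot_ideal sKH).
Proof.
have [rows ur rP] := exists_rows; have [cols uc cP] := exists_cols.
have [i0 [j0 [z [zf fz]]]] := exists_invertible_form.
exact: (enumerated_heredity ur rP uc cP zf fz).
Qed.

End CellHeredity.

(** Sorting by the number of larger elements puts larger elements first. *)
Lemma exists_linear_extension (d : Order.disp_t) (L : porderType d) (s : seq L) :
  uniq s -> (forall l, l \in s) ->
  exists s' : seq L, [/\ uniq s', forall l, l \in s'
    & forall l m, (l < m)%O -> (index m s' < index l s')%N].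
Proof.
move=> us sL; pose key l := count (fun m => l < m)%O s.
pose leK : rel L := relpre key leq.
exists (sort leK s); split=> [|l|l m lm]; rewrite ?sort_uniq ?mem_sort //.
have totK : total leK by move=> x y; apply: leq_total.
rewrite ltnNge; apply/negP => le.
have trK : transitive leK by move=> x y z; apply: leq_trans.
have reK : reflexive leK by move=> x; apply: leqnn.
have := @sorted_leq_index _ leK trK reK _ (sort_sorted totK s) l m.
rewrite !mem_sort !sL => /(_ isT isT le); rewrite /leK /= leqNgt => /negP[].
have := count_predUI (fun x => m < x)%O (pred1 m) s.
rewrite (@eq_count _ (predI _ _) pred0); last first.
  by move=> x /=; case: eqP => [->|]; rewrite ?ltxx ?andbF.
rewrite count_pred0 addn0 count_uniq_mem // sL addn1 => <-.
by apply: sub_count => x /= /orP[/(lt_trans lm)|/eqP->].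
Qed.

Lemma irr_system_quasi_hereditary (k : fieldType) (A : falgType k) :
  has_irr_divisible_system A -> quasi_hereditary A.
Proof.
move=> [d [L [I [J [D [c [divc irrc]]]]]]].
have [sT usT sTP] := exists_full_seq (cell_index_bounded c).
have [|l|s [us sP s_lt]] := @exists_linear_extension _ L (undup [seq tag t | t <- sT]).
- exact: undup_uniq.
- rewrite mem_undup; have [[i] [j]] := (cell_I0 c l, cell_J0 c l).
  by apply/mapP; exists (Tagged (fun l => (I l * J l)%type) (i, j)).
pose P n : pred L := fun l => (index l s < n)%N.
have upP n l m : P n l -> (l < m)%O -> P n m.
  by move=> Pl /s_lt lt; apply: ltn_trans Pl.
pose Jd n := cell_ideal c (@upP n).
have sJ n : {subset Jd n <= Jd n.+1}.
  move=> a /cell_spanP Ha; apply/cell_spanP => l i j Pl; apply: Ha.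
  by apply: contra Pl; apply: leqW.
exists (size s), Jd, sJ; split=> [x|x|n ns].
- split=> [/cell_spanP H|->]; last by apply: (proj1 (left_ideal_zmod _)).
  have [s' [_ _ ->]] := is_coord_cell_coord c x.
  by rewrite big1 // => -[l [i j]] _ /=; rewrite H // raddf0.
- by apply/cell_spanP => l i j; rewrite /P index_mem sP.
have [l lE] : exists l, index l s = n.
  case: (s) us ns => [//|l0 s0] us ns.
  by exists (nth l0 (l0 :: s0) n); rewrite index_uniq.
apply: (@cell_ideal_heredity _ _ _ _ _ _ _ _ (P n) (P n.+1) l) => //.
- by rewrite /P lE ltnn.
- move=> m; rewrite /P ltnS leq_eqVlt orbC; congr (_ || _).
  apply/eqP/eqP => [mE|->//]; rewrite -(nth_index m (sP m)) mE -lE.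
  by rewrite (nth_index m (sP l)).
Qed.

(** The same system serves both sides: x = (x y) f(j, i) when y inverts f(j, i). *)
Lemma irr_divisible_full (k : fieldType) (A : algType k) :
  has_irr_divisible_system A <-> has_full_divisible_system A.
Proof.
split=> -[d [L [I [J [D [c [H1 H2]]]]]]]; exists d, L, I, J, D, c; split=> // l.
  move=> x; have [j [i ji]] := Lambda_irr_form (H2 l); have [y [yf _]] := H1 l _ ji.
  exists (tens (@Deltaop_b _ _ _ _ _ _ _ c l j (x * y)) (@Delta_a _ _ _ _ _ _ _ c l i 1)).
  by rewrite phi_tens mulr1 -mulrA yf mulr1.
have [t t1] := H1 l 1; exists t; rewrite t1; exact/eqP/oner_neq0.
Qed.

Theorem theorem5p3 (k : fieldType) (A : falgType k) :
  (quasi_hereditary A <-> has_irr_divisible_system A) /\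
  (has_irr_divisible_system A <-> has_full_divisible_system A).
Proof.
split; last exact: irr_divisible_full.
split=> [qhA|]; last exact: irr_system_quasi_hereditary.
exact/layer_chain_system/quasi_hereditary_chain.
Qed.
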